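(* Let $n\ge2$ and let $\mathcal{CT}_n$ be the arrangement in $\mathbb{R}^n$ with hyperplanes $x_i+x_j=-2,-1,0$ for all $1\le i<j\le n$. A symmetric sketch (an order on the letters of $C(n)$) is $\mathcal{CT}$ maximal if and only if the following hold. (1) If a $\beta$-letter is immediately followed by an $\alpha$-letter, then they are of opposite signs and have different mod-values. (2) If two $\alpha$-letters are consecutive, their corresponding $\beta$-letters are also consecutive, and they are of the same sign, then the subscript of the first one is greater than that of the second. (3) If the $n$-th and $(n+1)$-th $\alpha$-letters are consecutive, then so are the $(n-1)$-th and $n$-th $\alpha$-letters, and the $n$-th $\alpha$-letter is positive. In such a situation, if the $(n-1)$-th $\alpha$-letter is negative and the $(n-1)$-th and $n$-th $\beta$-letters are consecutive, then the $(n-1)$-th $\alpha$-letter has a subscript greater than that of the $(n+1)$-th $\alpha$-letter. (4) If the $(2n-1)$-th and $(2n+1)$-th letters of the sketch are both $\beta$-letters of the same sign and their corresponding $\alpha$-letters are consecutive, then the subscript of the $(2n-1)$-th letter is greater than that of the $(2n+1)$-th letter. Hence the regions of $\mathcal{CT}_n$ are in bijection with the symmetric sketches satisfying (1)–(4).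
   Context: $\mathcal{CT}_n$ is the translate (by $X_i=x_i+\tfrac12$) of the Catalan threshold arrangement $X_i+X_j=-1,0,1$. A region of an arrangement is a connected component of the complement of the union of its hyperplanes. $[n]=\{1,\dots,n\}$. Let $C(n)$ be the set of $4n$ letters $\alpha_i^{(s)}$ and $\alpha_{-i}^{(-s)}$ with $i\in[n]$, $s\in\{0,1\}$, representing $x_i+s$ and $-x_i-s$ respectively. The conjugate of $\alpha_i^{(s)}\in C(n)$ is $\overline{\alpha_i^{(s)}}=\alpha_{-i}^{(-s)}$. A symmetric sketch is a total order on $C(n)$ (a word $w_1\cdots w_{4n}$ using each letter once) such that, whenever the letters involved belong to $C(n)$: (i) if $\alpha_i^{(s)}$ appears before $\alpha_j^{(t)}$ then $\overline{\alpha_j^{(t)}}$ appears before $\overline{\alpha_i^{(s)}}$; (ii) if $\alpha_i^{(s-1)}$ appears before $\alpha_j^{(t-1)}$ then $\alpha_i^{(s)}$ appears before $\alpha_j^{(t)}$; (iii) $\alpha_i^{(s-1)}$ appears before $\alpha_i^{(s)}$. Symmetric sketches correspond bijectively to the regions of the arrangement $\mathcal{C}_n$ in $\mathbb{R}^n$ with hyperplanes $2x_i=-2,-1,0$ ($i\in[n]$), $x_i+x_j=-2,-1,0$, $x_i-x_j=-1,0,1$ ($1\le i<j\le n$): a sketch corresponds to the region of points for which the represented real numbers are strictly increasing along the word. The $\alpha$-letters are $\alpha_i^{(0)}$ and $\alpha_{-i}^{(-1)}$ ($i\in[n]$); the other letters are $\beta$-letters. The $\beta$-letter corresponding to an $\alpha$-letter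 (and vice versa) is the one with the same subscript. A letter is positive or negative according to the sign of its subscript; the mod-value of $\alpha_i^{(s)}$ is $|i|$. ''Consecutive'' means in adjacent positions of the word. Two symmetric sketches are $\mathcal{CT}$ equivalent if their regions of $\mathcal{C}_n$ lie in the same region of $\mathcal{CT}_n$. Sketches are compared in the lexicographic order induced by the order on letters $$\alpha_n^{(0)}\succ\cdots\succ\alpha_1^{(0)}\succ\alpha_{-1}^{(-1)}\succ\cdots\succ\alpha_{-n}^{(-1)}\succ\alpha_n^{(1)}\succ\cdots\succ\alpha_1^{(1)}\succ\alpha_{-1}^{(0)}\succ\cdots\succ\alpha_{-n}^{(0)}.$$ A sketch is $\mathcal{CT}$ maximal if it is greater than all other sketches to which it is $\mathcal{CT}$ equivalent. *)

(* Defs.v *)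
From mathcomp Require Import all_boot all_order all_algebra.
From mathcomp Require Import all_classical all_reals all_analysis.

Set Implicit Arguments.
Unset Strict Implicit.
Unset Printing Implicit Defensive.

Import Order.TTheory GRing.Theory Num.Theory.
Import numFieldNormedType.Exports.

Local Open Scope classical_set_scope.
Local Open Scope ring_scope.

Section Letters.
Variable n : nat.

(* The 4n letters: (true, i, s) stands for alpha_{i+1}^{(s)} and (false, i, s)
   for alpha_{-(i+1)}^{(-s)}, where i : 'I_n is 0-based and s is 0 or 1. *)
Definition letter : Type := (bool * 'I_n * bool)%type.

Definition positive (a : letter) : bool := a.1.1.
Definition negative (a : letter) : bool := ~~ positive a.

Definition subscript (a : letter) : int :=
  if positive a then (a.1.2).+1%:Z else - (a.1.2).+1%:Z.

Definition superscript (a : letter) : int :=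
  if positive a then (a.2 : nat)%:Z else - (a.2 : nat)%:Z.

Definition mod_value (a : letter) : nat := `|subscript a|%N.

Definition conjugate (a : letter) : letter := (~~ a.1.1, a.1.2, a.2).

Definition is_alpha (a : letter) : bool :=
  superscript a == (if positive a then 0 else -1).
Definition is_beta (a : letter) : bool := ~~ is_alpha a.

(* The other letter with the same subscript; it exchanges alpha-letters and
   beta-letters. *)
Definition partner (a : letter) : letter := (a.1.1, a.1.2, ~~ a.2).

(* a' is the letter obtained from a by adding 1 to its superscript. *)
Definition raises (a a' : letter) : Prop :=
  subscript a' = subscript a /\ superscript a' = superscript a + 1.

Definition word : Type := ((4 * n).-tuple letter)%type.

Definition before (w : word) (a b : letter) : bool :=
  (index a w < index b w)%N.

Definition immediately_before (w : word) (a b : letter) : bool :=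
  index b w == (index a w).+1.

Definition consecutive (w : word) (a b : letter) : bool :=
  immediately_before w a b || immediately_before w b a.

Definition symmetric_sketch (w : word) : Prop :=
  [/\ uniq w /\ (forall a : letter, a \in w),
      forall a b : letter,
        before w a b -> before w (conjugate b) (conjugate a),
      forall a b a' b' : letter, raises a a' -> raises b b' ->
        before w a b -> before w a' b'
    & forall a a' : letter, raises a a' -> before w a a'].

(* Every alpha-letter is larger than every beta-letter, and letters of the same
   kind are compared by subscript: this is the lexicographic order on
   (is_alpha a, subscript a), with false < true. *)
Definition letter_key (a : letter) : (bool *l int)%type :=
  (is_alpha a, subscript a).

Definition word_lt (u v : word) : bool :=
  (([tuple of map letter_key u] : (4 * n).-tuplelexi (bool *l int)%type)
     < ([tuple of map letter_key v] : (4 * n).-tuplelexi (bool *l int)%type))%O.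

End Letters.

Section Regions.
Variables (R : realType) (n : nat).

Definition arrangement_complement (A : set (set 'rV[R]_n)) : set 'rV[R]_n :=
  ~` \bigcup_(H in A) H.

Definition regions (A : set (set 'rV[R]_n)) : set (set 'rV[R]_n) :=
  [set C | exists2 x, arrangement_complement A x
           & C = connected_component (arrangement_complement A) x].

Definition CT_arrangement : set (set 'rV[R]_n) :=
  [set H | exists i j : 'I_n, exists c : R,
     [/\ (i < j)%N, c \in [:: -2; -1; 0]
       & H = [set x : 'rV[R]_n | x ord0 i + x ord0 j = c]]].

Definition letter_value (x : 'rV[R]_n) (a : letter n) : R :=
  if positive a then x ord0 a.1.2 + (a.2 : nat)%:R
  else - x ord0 a.1.2 - (a.2 : nat)%:R.

Definition sketch_region (w : word n) : set 'rV[R]_n :=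
  [set x | sorted <%R [seq letter_value x a | a <- w]].

Definition CT_equivalent (u v : word n) : Prop :=
  exists C, [/\ regions CT_arrangement C,
    sketch_region u `<=` C & sketch_region v `<=` C].

Definition CT_maximal (w : word n) : Prop :=
  symmetric_sketch w /\
  forall u : word n, symmetric_sketch u -> u <> w -> CT_equivalent w u ->
    word_lt u w.

End Regions.

Section Conditions.
Variables (n : nat) (w : word n).

(* a is the k-th item of s, counted from 1. *)
Definition kth (s : seq (letter n)) (k : nat) (a : letter n) : Prop :=
  (0 < k)%N /\ onth s k.-1 = Some a.

Definition alphas : seq (letter n) := [seq a <- w | is_alpha a].
Definition betas : seq (letter n) := [seq a <- w | is_beta a].

Definition CT_condition1 : Prop :=
  forall a b : letter n, is_beta a -> is_alpha b ->
    immediately_before w a b ->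
    positive a != positive b /\ mod_value a != mod_value b.

Definition CT_condition2 : Prop :=
  forall a b : letter n, is_alpha a -> is_alpha b ->
    immediately_before w a b ->
    consecutive w (partner a) (partner b) ->
    positive a = positive b ->
    subscript b < subscript a.

Definition CT_condition3 : Prop :=
  forall a b c : letter n,
    kth alphas (n - 1) a -> kth alphas n b -> kth alphas (n + 1) c ->
    consecutive w b c ->
    [/\ consecutive w a b,
        positive b
      & negative a ->
        (forall a' b' : letter n,
           kth betas (n - 1) a' -> kth betas n b' -> consecutive w a' b') ->
        subscript c < subscript a].

Definition CT_condition4 : Prop :=
  forall a b : letter n,
    kth w (2 * n - 1) a -> kth w (2 * n + 1) b ->
    is_beta a -> is_beta b -> positive a = positive b ->
    consecutive w (partner a) (partner b) ->
    subscript b < subscript a.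

Definition CT_conditions : Prop :=
  [/\ CT_condition1, CT_condition2, CT_condition3 & CT_condition4].

End Conditions.

(* Main.v *)
Require Import Defs.
From mathcomp Require Import all_boot all_order all_algebra.
From mathcomp Require Import all_classical all_reals all_analysis.
From mathcomp Require Import perm zify ring lra.

Set Implicit Arguments.
Unset Strict Implicit.
Unset Printing Implicit Defensive.

Import Order.TTheory GRing.Theory Num.Theory.
Import numFieldNormedType.Exports.

(** Write y_s for the value of the alpha-letter of subscript s, so that its
    beta-letter stands for y_s + 1 and y_(-s) = - 1 - y_s. A symmetric sketch
    records how the numbers y_s and y_s + 1 interleave. The hyperplanes
    x_i + x_j = -2, -1, 0 only see the comparisons of letters of opposite
    signs and different mod-values ([opposed]); by convexity two sketches are
    equivalent exactly when they order these pairs alike ([CT_equivalentP]),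
    provided that every sketch is realized by a point ([realize]) and that
    every region contains points with distinct letter values ([perturb]).
    The theorem is thereby reduced to a statement about words: within a set of
    sketches that agree on all opposed pairs, the largest one is the only one
    that satisfies the four conditions.

    A largest sketch satisfies the conditions because each violation exhibits
    a larger sketch in the same class ([maximal_conditions]). The larger
    sketch is produced by three moves that respect opposed pairs: swapping an
    adjacent beta-letter and alpha-letter that are not opposed, together with
    the mirror image of that swap ([swap_beta_alpha]); exchanging two subscripts
    of the same sign that no opposed letter separates ([relabel_exchange]);
    and exchanging c with -c when their alpha-letters are adjacent
    ([relabel_flip]). Most violations need one move; those of the condition on
    the middle alpha-letters need a flip followed by another move.

    Conversely, let u satisfy the conditions, let w be equivalent to u, and
    look at the first place where they differ ([conditions_maximal]). Suppose
    that w has the larger letter there. It is an alpha-letter, alpha s, and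
    every letter that stands in u between that place and alpha s is overtaken
    by alpha s in w, hence is not opposed to alpha s. On the other hand the
    first condition says that in u a beta-letter followed by an alpha-letter is
    opposed to it, and these two keep their order in w. Following these two
    kinds of pairs, and using that conjugation reverses both words, one is led
    to a contradiction when u has a beta-letter at that place
    ([first_diff_alpha_beta]). When u has an alpha-letter alpha t there, with
    t < s, the same argument shows that the letters from alpha t to
    alpha s in u are all alpha-letters ([run_no_beta]); somewhere among them
    the subscript increases, so by the second condition the corresponding
    beta-letters are separated by an alpha-letter, which can only be that of
    subscript -s ([ascent_next_alpha]); this happens only around the middle of
    the word, where the last two conditions exclude it
    ([first_diff_alpha_alpha]).

    Finally every class has a largest sketch, so that sending a sketch that
    satisfies the conditions to the region containing its points is the
    desired bijection. *)

(** * Letters, signed subscripts and positions *)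

(** The pair (b, i) encodes the subscript of sign b and absolute value i + 1.
    Every subscript carries one alpha-letter and one beta-letter, so a letter
    amounts to a kind and a signed subscript, and conjugation changes both. *)
Definition signed (n : nat) : Type := (bool * 'I_n)%type.

Definition neg n (s : signed n) : signed n := (~~ s.1, s.2).

(** The last component of a letter is the absolute value of its superscript;
    on alpha-letters it is 0 or 1 according to the sign of the subscript,
    whence the exclusive or. *)
Definition lett n (k : bool) (s : signed n) : letter n := (s, k (+) s.1).

Arguments neg {n} s.
Arguments lett {n} k s.

Notation alpha := (lett true).
Notation beta := (lett false).

Section Letters.
Variable n : nat.
Implicit Types (s t : signed n) (x y : letter n).

Definition kind x : bool := x.2 (+) x.1.1.

Lemma lett_kind x : lett (kind x) x.1 = x.
Proof. by case: x => [[b i] c]; rewrite /lett /kind /= -addbA addbb addbF. Qed.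

Lemma kind_lett k s : kind (lett k s) = k.
Proof. by rewrite /kind /= -addbA addbb addbF. Qed.

Lemma lett_inj k k' s s' : lett k s = lett k' s' -> k = k' /\ s = s'.
Proof. by move=> e; rewrite -(kind_lett k s) e kind_lett; case: e. Qed.

Lemma negK : involutive (@neg n).
Proof. by case=> [b i]; rewrite /neg /= negbK. Qed.

Lemma neg_inj : injective (@neg n).
Proof. exact: inv_inj negK. Qed.

Lemma neq_neg s : (s == neg s) = false.
Proof. by case: s => [[] i]. Qed.

Lemma eq_or_neg s t : s.2 = t.2 -> s = t \/ s = neg t.
Proof. by case: s t => [[] i] [[] j] /= ->; [left|right|right|left]. Qed.

Lemma eq_signed s t : s.1 = t.1 -> s.2 = t.2 -> s = t.
Proof. by case: s t => [b i] [c j] /= -> ->. Qed.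

Lemma conjugate_lett k s : conjugate (lett k s) = lett (~~ k) (neg s).
Proof. by case: s => b i; rewrite /conjugate /lett /neg /=; case: k b => [] []. Qed.

Lemma is_alphaE x : is_alpha x = kind x.
Proof. by case: x => [[[] i] []]. Qed.

Lemma is_betaE x : is_beta x = ~~ kind x.
Proof. by rewrite /is_beta is_alphaE. Qed.

Lemma partner_lett k s : partner (lett k s) = lett (~~ k) s.
Proof. by case: s => [[] i]; case: k. Qed.

Definition toint (s : signed n) : int :=
  (if s.1 then s.2.+1%:Z else - s.2.+1%:Z)%R.

Lemma subscript_lett k s : subscript (lett k s) = toint s.
Proof. by []. Qed.

Lemma toint_inj : injective toint.
Proof.
case=> [b i] [c j]; rewrite /toint /= => e.
have [-> /ord_inj -> //] : b = c /\ i = j :> nat.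
by case: b c e => [] [] e; split=> //; (lia || (exfalso; lia)).
Qed.

Lemma toint_neg s : toint (neg s) = (- toint s)%R.
Proof. by case: s => [[] i]; rewrite /toint /= ?opprK. Qed.

Lemma toint_sign s : (0 < toint s)%R = s.1.
Proof. case: s => [[] i]; rewrite /toint //=. Qed.

Lemma raisesP x y :
  raises x y <-> exists s, x = alpha s /\ y = beta s.
Proof.
split=> [|[[b i] [-> ->]]]; last first.
  by split; case: b.
case: x y => [[b i] k] [[c j] l] [] e1 e2; exists (b, i).
have [ebc eij] : c = b /\ j = i.
  have /(@toint_inj (c, j) (b, i)) [-> -> //] : toint (c, j) = toint (b, i) by [].
subst; move: e2; rewrite /superscript /lett /=.
by case: b k l {e1} => [] [] [].
Qed.

Lemma card_letter : #|{: letter n}| = (4 * n)%N.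
Proof. by rewrite !card_prod card_bool card_ord; lia. Qed.

Lemma card_signed : #|{: signed n}| = (2 * n)%N.
Proof. by rewrite card_prod card_bool card_ord. Qed.

(** For i <> j, comparing x_i + s with - x_j - t is comparing x_i + x_j with
    - s - t, one of 0, -1, -2: opposed pairs are the pairs of letters whose
    order is constant on the regions of the arrangement. *)
Definition opposed x y : bool :=
  (x.1.1 != y.1.1) && (x.1.2 != y.1.2).

Lemma opposedC x y : opposed x y = opposed y x.
Proof. by rewrite /opposed eq_sym [X in _ && ~~ X]eq_sym. Qed.

Definition pos (w : word n) x : nat := index x w.

(** Although stated as an implication, this is a symmetric relation on
    duplicate-free words, because [opposed] is symmetric. *)
Definition same_class (u w : word n) : Prop :=
  forall x y, opposed x y -> (pos u x < pos u y)%N -> (pos w x < pos w y)%N.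

Lemma wordP (w : word n) : uniq w -> forall x, x \in w.
Proof.
move=> uw x.
have e : #|[pred x in (w : seq _)]| = #|{: letter n}|.
  by rewrite (card_uniqP uw) size_tuple card_letter.
have /subset_cardP/(_ (subset_predT _)) := e.
by move/(_ x); rewrite !inE.
Qed.

Lemma pos_lt_size (w : word n) x : uniq w -> (pos w x < 4 * n)%N.
Proof. by move=> uw; rewrite -[X in (_ < X)%N](size_tuple w) index_mem wordP. Qed.

Lemma pos_inj (w : word n) : uniq w -> injective (pos w).
Proof.
move=> uw x y e; rewrite -(nth_index x (wordP uw x)) -(nth_index x (wordP uw y)).
by congr nth.
Qed.

Lemma pos_surj (w : word n) k : uniq w -> (k < 4 * n)%N ->
  exists b s, pos w (lett b s) = k.
Proof.
move=> uw kn; have n0 : (0 < n)%N by lia.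
pose x := nth (true, Ordinal n0, true) w k.
exists (kind x), x.1; rewrite lett_kind /pos index_uniq ?size_tuple //.
Qed.

(** The axioms of symmetric sketches as inequalities between positions:
    conjugation sends position k to 4n - 1 - k, and raising the superscript
    is only possible from an alpha-letter to its beta-letter. *)
Record sketch (w : word n) : Prop := Sketch {
  sk_uniq : uniq w;
  sk_alpha_beta : forall s, (pos w (alpha s) < pos w (beta s))%N;
  sk_mono : forall s t, (pos w (alpha s) < pos w (alpha t))%N ->
                        (pos w (beta s) < pos w (beta t))%N;
  sk_conj : forall s, (pos w (alpha s) + pos w (beta (neg s))).+1 = (4 * n)%N }.

End Letters.

(** * Symmetric sketches in terms of positions *)

Section Sketches.
Variable n : nat.
Implicit Types (w u : word n) (s t : signed n).

(** Conjugation reverses the order of the letters, so by induction from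
    either end it must reverse positions. *)
Lemma pos_conjugate w : symmetric_sketch w ->
  forall x, (pos w x + pos w (conjugate x)).+1 = (4 * n)%N.
Proof.
case=> [[uw _] conjw _ _] x.
have lower k : forall x, pos w x = k -> (pos w x + pos w (conjugate x) < 4 * n)%N.
  elim: k => [|k IHk] {}x xk; first by rewrite xk pos_lt_size.
  have := pos_lt_size x uw; rewrite xk => kn.
  have [b [s yk]] := pos_surj uw (ltnW kn).
  have /conjw : before w (lett b s) x by rewrite /before -!/(pos _ _) yk xk.
  rewrite /before -!/(pos _ _); move: (IHk _ yk); lia.
have upper k : forall x, (pos w x + k).+1 = (4 * n)%N ->
    (4 * n <= (pos w x + pos w (conjugate x)).+1)%N.
  elim: k => [|k IHk] {}x xk; first by lia.
  have kn : ((pos w x).+1 < 4 * n)%N by lia.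
  have [b [s yk]] := pos_surj uw kn.
  have /conjw : before w x (lett b s) by rewrite /before -!/(pos _ _) yk.
  rewrite /before -!/(pos _ _).
  have := IHk (lett b s); rewrite yk => /(_ _); lia.
have := pos_lt_size x uw.
move: (lower _ x erefl) (upper (4 * n - (pos w x).+1)%N x); lia.
Qed.

Lemma sketchP w : symmetric_sketch w <-> sketch w.
Proof.
split=> [sw|[uw ab mono conjw]].
  have conjw := pos_conjugate sw.
  case: sw => [[uw _] _ raisew abw]; split=> //.
  - by move=> s; apply: abw; apply/raisesP; exists s.
  - by move=> s t; apply: raisew; apply/raisesP; [exists s|exists t].
split.
- by split=> // a; apply: wordP.
- have conjE x : (pos w x + pos w (conjugate x)).+1 = (4 * n)%N.
    rewrite -(lett_kind x) conjugate_lett; case: (kind x); first exact: conjw.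
    by rewrite addnC -[X in pos w (beta X)]negK conjw.
  move=> a b; rewrite /before -!/(pos _ _).
  by have := conjE a; have := conjE b; lia.
- by move=> a b a' b' /raisesP [s [-> ->]] /raisesP [t [-> ->]]; apply: mono.
- by move=> a a' /raisesP [s [-> ->]]; apply: ab.
Qed.

Section OneSketch.
Variable w : word n.
Hypothesis skw : sketch w.

Lemma pos_neg k s : (pos w (lett k s) + pos w (lett (~~ k) (neg s))).+1 = (4 * n)%N.
Proof.
case: k; first exact: (sk_conj skw).
by rewrite addnC -[X in pos w (beta X)]negK (sk_conj skw).
Qed.

Lemma pos_eq k s k' s' : pos w (lett k s) = pos w (lett k' s') -> k = k' /\ s = s'.
Proof. by move/(pos_inj (sk_uniq skw))/lett_inj. Qed.

Lemma beta_mono s t :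
  (pos w (beta s) < pos w (beta t))%N = (pos w (alpha s) < pos w (alpha t))%N.
Proof.
apply/idP/idP; last exact: (sk_mono skw).
have [//|lt_ts|/pos_eq[_ ->]] := ltngtP (pos w (alpha s)) (pos w (alpha t)).
  by have := sk_mono skw lt_ts; lia.
by rewrite ltnn.
Qed.

Lemma alpha_neg s t :
  (pos w (alpha (neg t)) < pos w (alpha (neg s)))%N = (pos w (alpha s) < pos w (alpha t))%N.
Proof.
rewrite -(beta_mono s t); have := pos_neg false s; have := pos_neg false t => /=; lia.
Qed.

Lemma alpha_negr s t :
  (pos w (alpha s) < pos w (alpha (neg t)))%N = (pos w (alpha t) < pos w (alpha (neg s)))%N.
Proof. by rewrite -{1}[s]negK alpha_neg. Qed.

End OneSketch.

End Sketches.

(** * The local conditions force maximality *)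

Section Conditions.
Variable n : nat.
Implicit Types (w u : word n) (s t : signed n).

(** The four conditions as arithmetic on positions, counted from 0. Since
    [neg] reverses the order of the alpha-letters, adjacent letters alpha c
    and alpha (neg c) are necessarily the n-th and (n+1)-st alpha-letters. *)
Record pos_conditions (w : word n) : Prop := PosConditions {
  cond_beta_alpha : forall s t, pos w (alpha t) = (pos w (beta s)).+1 -> opposed (beta s) (alpha t);
  cond_alpha_alpha : forall s t, pos w (alpha t) = (pos w (alpha s)).+1 ->
    pos w (beta t) = (pos w (beta s)).+1 -> s.1 = t.1 -> (toint t < toint s)%R;
  cond_middle : forall c, pos w (alpha (neg c)) = (pos w (alpha c)).+1 ->
    c.1 /\ exists e, pos w (alpha c) = (pos w (alpha e)).+1 /\
     (~~ e.1 -> pos w (beta c) = (pos w (beta e)).+1 -> (toint (neg c) < toint e)%R);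
  cond_beta_beta : forall s t, (pos w (beta s)).+2 = (2 * n)%N -> pos w (beta t) = (2 * n)%N ->
    s.1 = t.1 -> pos w (alpha t) = (pos w (alpha s)).+1 -> (toint t < toint s)%R }.

Lemma ascent (f : nat -> int) p q : (p <= q)%N -> (f p < f q)%R ->
  exists k, [/\ (p <= k)%N, (k < q)%N & (f k < f k.+1)%R].
Proof.
elim: q => [|q IHq] lepq fpq.
  by move: lepq fpq; rewrite leqn0 => /eqP ->; rewrite ltxx.
have lepq' : (p <= q)%N.
  by move: lepq fpq; rewrite leq_eqVlt => /orP[/eqP ->|//]; rewrite ltxx.
have [fq|fq] := ltP (f q) (f q.+1); first by exists q.
have [k [pk kq fk]] := IHq lepq' (lt_le_trans fpq fq).
by exists k; split=> //; lia.
Qed.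

Lemma letter_key_lt k s k' t :
  (letter_key (lett k s) < letter_key (lett k' t))%O =
  (~~ k && k') || ((k == k') && (toint s < toint t)%R).
Proof.
rewrite /letter_key !is_alphaE !kind_lett !subscript_lett ltEprodlexi /=.
by case: k k' => [] [].
Qed.

Lemma letter_key_inj : injective (@letter_key n).
Proof.
move=> x y; rewrite -(lett_kind x) -(lett_kind y).
move: (kind x) (kind y) x.1 y.1 => k k' s t.
by rewrite /letter_key !is_alphaE !kind_lett !subscript_lett => -[-> /toint_inj ->].
Qed.

Lemma nth_pos w x0 x : uniq w -> nth x0 w (pos w x) = x.
Proof. by move=> uw; rewrite nth_index ?wordP. Qed.

Lemma pos_tnth w i : uniq w -> pos w (tnth w i) = i.
Proof. by move=> uw; rewrite /pos (tnth_nth (tnth w i)) index_uniq ?size_tuple. Qed.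

Lemma word_lt_at u w x y : uniq u -> uniq w ->
  (forall z, (pos u z < pos u x)%N -> pos w z = pos u z) -> pos w y = pos u x ->
  (letter_key x < letter_key y)%O -> word_lt u w.
Proof.
move=> uu uw agr yx lt_xy; apply/ltxi_tuplePlt.
have kn := pos_lt_size x uu; pose k := Ordinal kn.
exists k => [i ik|]; last first.
  by rewrite !tnth_map !(tnth_nth x) /= nth_pos // -yx nth_pos.
rewrite !tnth_map; congr letter_key; apply: (pos_inj uw).
by rewrite pos_tnth // agr pos_tnth.
Qed.

Lemma word_ltP u w : uniq u -> uniq w -> word_lt u w ->
  exists x y, [/\ pos w y = pos u x, (letter_key x < letter_key y)%O &
    forall z, (pos u z < pos u x)%N -> pos w z = pos u z].
Proof.
move=> uu uw /ltxi_tuplePlt [k kP].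
rewrite !tnth_map => lt_k; exists (tnth u k), (tnth w k).
rewrite !pos_tnth //; split=> // z zk.
have zn := pos_lt_size z uu; pose i := Ordinal zn.
have := kP i zk; rewrite !tnth_map => /letter_key_inj.
by rewrite (tnth_nth z u) nth_pos // => {1}->; rewrite pos_tnth.
Qed.

Lemma word_lt_total u w : uniq u -> uniq w -> u != w -> word_lt u w || word_lt w u.
Proof.
move=> uu uw; apply: contraR; rewrite /word_lt.
case: ltgtP => // /(congr1 val) /= /(inj_map letter_key_inj) e _.
exact/eqP/val_inj.
Qed.

(** From here on u satisfies the conditions, w lies in the same class, and the
    two words have the same first p letters. *)
Section Core.
Variables (u w : word n) (p : nat).
Hypothesis sku : sketch u.
Hypothesis skw : sketch w.
Hypothesis gu : pos_conditions u.
Hypothesis same : same_class u w.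
Hypothesis agree : forall x, (pos u x < p)%N -> pos w x = pos u x.

Local Notation P := (pos u).
Local Notation Q := (pos w).

Lemma sameE x y : opposed x y -> (P x < P y)%N = (Q x < Q y)%N.
Proof.
move=> l; apply/idP/idP; first exact: same.
have l' : opposed y x by rewrite opposedC.
have [//|/(same l')|/(pos_inj (sk_uniq sku)) ->] := ltngtP (P x) (P y); first by lia.
by rewrite ltnn.
Qed.

Lemma agreeP x : (Q x < p)%N -> P x = Q x.
Proof.
move=> xp; have xn := pos_lt_size x (sk_uniq skw).
have [b [s e]] := pos_surj (sk_uniq sku) xn.
have : Q (lett b s) = Q x by rewrite agree e.
by move/(pos_inj (sk_uniq skw)) <-; rewrite agree ?e //; move: xp e; lia.
Qed.

Lemma agree_ge x : (p <= Q x)%N = (p <= P x)%N.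
Proof.
apply/idP/idP => h; rewrite leqNgt; apply/negP => h'.
  by have := agree h'; lia.
by have := agreeP h'; lia.
Qed.

(** The alpha-letters that u has strictly between those of c and neg c are
    permuted by [neg], so if there are any, one of them has the sign opposite
    to c. It follows alpha c in u, hence in w; but in w it follows
    alpha (neg c) as well as its own negative does, and symmetry then
    puts it before alpha c. So there are none. A beta-letter just before
    alpha (neg c) would be opposed to it and yet be overtaken by it in w. *)
Lemma middle c : (P (alpha c) < P (alpha (neg c)))%N -> (p <= P (alpha c))%N ->
  Q (alpha (neg c)) = p ->
  [/\ c.1, P (alpha (neg c)) = (P (alpha c)).+1 &
    exists e, P (alpha c) = (P (alpha e)).+1 /\
     (~~ e.1 -> P (beta c) = (P (beta e)).+1 -> (toint (neg c) < toint e)%R)].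
Proof.
move=> lt_c le_pc Qc.
have no_opp d : d.1 != c.1 -> d.2 != c.2 -> (P (alpha c) < P (alpha d))%N ->
    (P (alpha d) < P (alpha (neg c)))%N -> False.
  move=> d1 d2 cd dc.
  have dc' : (P (alpha c) < P (alpha (neg d)))%N.
    by rewrite (alpha_negr sku).
  have lcd : opposed (alpha c) (alpha d) by rewrite /opposed /= eq_sym d1 eq_sym d2.
  have Qcd : (Q (alpha c) < Q (alpha d))%N by rewrite -sameE.
  have Qd : (p <= Q (alpha (neg d)))%N by rewrite agree_ge; lia.
  have Qne : Q (alpha (neg d)) <> Q (alpha (neg c)).
    by move/(pos_eq skw) => [_ /(@neg_inj n) e]; rewrite e eqxx in d1.
  by have := alpha_neg skw d c; lia.
have none d : (P (alpha c) < P (alpha d))%N -> (P (alpha d) < P (alpha (neg c)))%N -> False.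
  move=> cd dc; have d2 : d.2 != c.2.
    by apply/eqP => /eq_or_neg [] e; move: cd dc; rewrite e; lia.
  have [e|d1] := eqVneq d.1 c.1; last exact: (no_opp d).
  apply: (no_opp (neg d)) => //=; first by rewrite e; case: (c.1).
    by rewrite (alpha_negr sku).
  by rewrite (alpha_neg sku).
have adj : P (alpha (neg c)) = (P (alpha c)).+1.
  have kn : ((P (alpha (neg c))).-1 < 4 * n)%N.
    by have := pos_lt_size (alpha (neg c)) (sk_uniq sku); lia.
  have [[] [e Pe]] := pos_surj (sk_uniq sku) kn.
    have [e_c|ne_c] := eqVneq e c; first by move: Pe; rewrite e_c; lia.
    have : P (alpha e) <> P (alpha c) by move/(pos_eq sku) => [_ /eqP]; rewrite (negbTE ne_c).
    by move=> ?; exfalso; apply: (none e); lia.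
  have adj_e : P (alpha (neg c)) = (P (beta e)).+1 by lia.
  have le := cond_beta_alpha gu adj_e.
  have := sameE le; have := agree_ge (beta e).
  lia.
have [c1 ce] := cond_middle gu adj.
by split.
Qed.

Lemma not_opposed k s k' t : ~~ opposed (lett k s) (lett k' t) ->
  s <> t -> s.1 = t.1 \/ t = neg s.
Proof.
rewrite negb_and !negbK /= => /orP[/eqP|/eqP] e ne; first by left.
by right; case: (eq_or_neg (esym e)) => // ets; case: ne.
Qed.

(** The first alpha-letter alpha c that u has after position p is preceded by
    an opposed letter beta v, so beta v comes before alpha c in w too, where
    both come after alpha s. Hence neither beta v nor alpha c is opposed to
    alpha s. This leaves s = neg c, which contradicts [middle] because alpha c
    is preceded by a beta-letter, or v = neg s; then beta v is the conjugate of
    alpha s, and the last p letters, which are common to u and w, give the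
    contradiction. *)
Lemma first_diff_alpha_beta s t :
  Q (alpha s) = p -> P (beta t) = p -> False.
Proof.
move=> Qs Pt.
have neqs : P (alpha s) <> p by rewrite -Pt => /(pos_eq sku)[].
have Ps : (p < P (alpha s))%N by have := agree_ge (alpha s); lia.
case: (@arg_minnP _ s (fun c => (p < P (alpha c))%N) (fun c => P (alpha c)) Ps).
move=> c pc cmin.
have kn : ((P (alpha c)).-1 < 4 * n)%N.
  by have := pos_lt_size (alpha c) (sk_uniq sku); lia.
have [[] [v Pv]] := pos_surj (sk_uniq sku) kn.
  have : P (alpha v) <> p by rewrite -Pt => /(pos_eq sku)[].
  by have := cmin v; lia.
have adj : P (alpha c) = (P (beta v)).+1 by lia.
have ovc := cond_beta_alpha gu adj.
have Qvc : (Q (beta v) < Q (alpha c))%N by rewrite -sameE //; lia.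
have Qv : (p < Q (beta v))%N.
  have : Q (beta v) <> p by rewrite -Qs => /(pos_eq skw)[].
  by have := agree_ge (beta v); lia.
have necs : c <> s by move=> e; move: Qvc; rewrite e; lia.
have Pcs : (P (alpha c) < P (alpha s))%N.
  have : P (alpha c) <> P (alpha s) by move/(pos_eq sku) => [_ /necs].
  by have := cmin s Ps; lia.
have nocs : ~~ opposed (alpha c) (alpha s).
  by apply/negP => /sameE; lia.
case: (not_opposed nocs necs) => [e1|e]; last first.
  have [|||_ _ [e' [e'c _]]] := @middle c; rewrite -?e; try lia.
  by move: e'c; rewrite adj => -[] /(pos_eq sku)[].
have novs : ~~ opposed (beta v) (alpha s).
  by apply/negP => /sameE; lia.
have nevs : v <> s by move=> e; move: ovc; rewrite e /opposed /= e1 eqxx.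
case: (not_opposed novs nevs) => [e|e].
  by move: ovc; rewrite /opposed /= e e1 eqxx.
have := pos_neg sku true s; have := pos_neg skw true s.
have := pos_neg sku true c; have := pos_neg skw true c => /=.
rewrite e negK; have := @agreeP (beta (neg c)); have := @agree (beta (neg c)).
move: Qvc Qs Pcs adj Qv; rewrite e; lia.
Qed.

Section AlphaAlpha.
Variables s t : signed n.
Hypotheses (Qs : Q (alpha s) = p) (Pt : P (alpha t) = p) (lt_ts : (toint t < toint s)%R).

Lemma first_diff_lt : (p < P (alpha s))%N.
Proof.
have : P (alpha s) <> p.
  by rewrite -Pt => /(pos_eq sku)[_ e]; move: lt_ts; rewrite e ltxx.
by have := agree_ge (alpha s); lia.
Qed.

(** Everything that u has from position p up to alpha s is overtaken by
    alpha s in w; this is why none of it can be opposed to alpha s. *)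
Lemma run_after x : (p <= P x)%N -> x <> alpha s -> (p < Q x)%N.
Proof.
move=> px ne; have : Q x <> p by rewrite -Qs => /(pos_inj (sk_uniq skw)).
by have := agree_ge x; lia.
Qed.

Lemma run_not_opposed x : (p <= P x)%N -> (P x < P (alpha s))%N ->
  ~~ opposed x (alpha s).
Proof.
move=> px xs; apply/negP => /sameE; rewrite xs Qs => /esym.
have := run_after px; have [->|/eqP ne /(_ ne)] := eqVneq x (alpha s); lia.
Qed.

Lemma run_sign c : (p <= P (alpha c))%N -> (P (alpha c) < P (alpha s))%N ->
  c.1 = s.1 \/ c = neg s.
Proof.
move=> pc cs.
case: (not_opposed (run_not_opposed pc cs)) => [e|e|->]; first by move: cs; rewrite e ltnn.
  by left.
by right; rewrite negK.
Qed.

Lemma run_middle : (p <= P (alpha (neg s)))%N -> (P (alpha (neg s)) < P (alpha s))%N ->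
  [/\ ~~ s.1, P (alpha s) = (P (alpha (neg s))).+1 &
    exists e, P (alpha (neg s)) = (P (alpha e)).+1 /\
     (~~ e.1 -> P (beta (neg s)) = (P (beta e)).+1 -> (toint s < toint e)%R)].
Proof. by move=> h1 h2; have := @middle (neg s); rewrite negK; apply. Qed.

(** Let beta v be the last beta-letter of u between position p and alpha s.
    The alpha-letter alpha d that follows is opposed to beta v, while neither
    is opposed to alpha s. If d = neg s, then [middle] wants an alpha-letter in
    place of beta v. Otherwise v = neg s, so beta v and alpha s are conjugate,
    and the conjugate of alpha d is a later beta-letter before alpha s. *)
Lemma run_no_beta v : (p < P (beta v))%N -> (P (beta v) < P (alpha s))%N -> False.
Proof.
move=> pv0 vs0.
have := @arg_maxnP _ v (fun c => (p < P (beta c) < P (alpha s))%N) (fun c => P (beta c)).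
rewrite pv0 vs0 => /(_ isT) [] {pv0 vs0}v /andP[pv vs] vmax.
have kn : ((P (beta v)).+1 < 4 * n)%N.
  by have := pos_lt_size (alpha s) (sk_uniq sku); lia.
have [[] [d Pd]] := pos_surj (sk_uniq sku) kn; last first.
  have : P (beta d) <> P (alpha s) by move/(pos_eq sku)=> [].
  by have := vmax d; lia.
have ovd := cond_beta_alpha gu Pd.
have nobs : ~~ opposed (beta v) (alpha s) by apply: run_not_opposed => //; lia.
have neds : d <> s by move=> e; move: nobs; rewrite -e ovd.
have : P (alpha d) <> P (alpha s) by move/(pos_eq sku)=> [_ /neds].
move=> Pneds; have Pds : (P (alpha d) < P (alpha s))%N by lia.
have pd : (p <= P (alpha d))%N by lia.
case: (run_sign pd Pds) => [e1|e]; last first.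
  subst d; have [_ _ [e [ec _]]] := run_middle pd Pds.
  by move: ec; rewrite Pd => -[] /(pos_eq sku)[].
have /eqP e2 : v.2 == s.2.
  by move: nobs ovd; rewrite /opposed /= e1 negb_and !negbK => /orP[->|].
case: (eq_or_neg e2) => e; first by move: ovd; rewrite e /opposed /= e1 eqxx.
have := pos_neg sku true s; have := pos_neg sku true d => /=; rewrite -e.
by have := vmax (neg d); lia.
Qed.

Lemma run_alpha k : (p <= k)%N -> (k <= P (alpha s))%N -> exists c, P (alpha c) = k.
Proof.
move=> pk ks.
have kn : (k < 4 * n)%N by have := pos_lt_size (alpha s) (sk_uniq sku); lia.
have [[] [d Pd]] := pos_surj (sk_uniq sku) kn; first by exists d.
exfalso; apply: (@run_no_beta d).
  have : P (beta d) <> P (alpha t) by move/(pos_eq sku)=> [].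
  by lia.
have : P (beta d) <> P (alpha s) by move/(pos_eq sku)=> [].
by lia.
Qed.

Lemma run_beta_after v : (p <= P (alpha v))%N -> (P (alpha s) < P (beta v))%N.
Proof.
move=> pv; have ab := sk_alpha_beta sku v.
rewrite ltnNge; apply/negP => vs.
have [||c /(pos_eq sku)[]//] := @run_alpha (P (beta v)); lia.
Qed.

(** Since alpha v and alpha v' are adjacent, the letter that follows beta v is
    an alpha-letter alpha f, opposed to beta v. If it were opposed to beta s
    too, then w would have beta v before alpha f before beta s, although
    alpha s overtakes alpha v in w, and so beta s overtakes beta v. *)
Lemma next_alpha_neg v v' : (p <= P (alpha v))%N -> (P (alpha v) < P (alpha s))%N ->
  v.1 = s.1 ->
  P (alpha v') = (P (alpha v)).+1 -> P (beta v') <> (P (beta v)).+1 ->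
  (P (beta v') <= P (beta s))%N ->
  P (alpha (neg s)) = (P (beta v)).+1 /\ (P (alpha (neg s)) < P (beta v'))%N.
Proof.
move=> pv vs v1 adj nadj v's.
have mono := @beta_mono _ _ sku.
have Pvv' : (P (beta v) < P (beta v'))%N by rewrite mono adj.
have kn : ((P (beta v)).+1 < 4 * n)%N.
  by have := pos_lt_size (beta v') (sk_uniq sku); lia.
have [[] [f Pf]] := pos_surj (sk_uniq sku) kn; last first.
  by have := mono v f; have := mono f v'; lia.
have Pfv' : (P (alpha f) < P (beta v'))%N by lia.
suff <- : f = neg s by [].
have ovf := cond_beta_alpha gu Pf.
have Qvf : (Q (beta v) < Q (alpha f))%N by rewrite -sameE //; lia.
have Qsv : (Q (beta s) < Q (beta v))%N.
  rewrite (beta_mono skw) Qs; apply: run_after => //.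
  by move=> /lett_inj [_ e]; move: vs; rewrite e ltnn.
have nofs : ~~ opposed (alpha f) (beta s) by apply/negP => /sameE; lia.
case: (not_opposed nofs) => [e|e|->]; last by rewrite negK.
  by move: ovf; rewrite e /opposed /= v1 eqxx.
by move: ovf; rewrite /opposed /= v1 e eqxx.
Qed.

Lemma ascent_next_alpha v v' : (p <= P (alpha v))%N ->
  P (alpha v') = (P (alpha v)).+1 -> (P (alpha v') <= P (alpha s))%N ->
  v.1 = s.1 -> v'.1 = s.1 -> (toint v < toint v')%R -> 
  P (alpha (neg s)) = (P (beta v)).+1 /\ (P (alpha (neg s)) < P (beta v'))%N.
Proof.
move=> pv adj v's v1 v1' vv'.
apply: next_alpha_neg => //; [lia| |].
  by move=> /(cond_alpha_alpha gu adj); rewrite v1 v1' => /(_ erefl); lia.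
by rewrite leqNgt (beta_mono sku) -leqNgt.
Qed.

Definition subscript_at k : int := toint (nth (alpha s) u k).1.

Lemma subscript_at_pos k c : subscript_at (P (lett k c)) = toint c.
Proof. by rewrite /subscript_at /pos nth_index // wordP ?(sk_uniq sku). Qed.

(** The subscripts at positions p to that of alpha c start at t, below that
    of c. *)
Lemma run_exists_ascent c : (P (alpha c) <= P (alpha s))%N -> (p <= P (alpha c))%N ->
  (toint t < toint c)%R ->
  exists v v', [/\ (p <= P (alpha v))%N, P (alpha v') = (P (alpha v)).+1,
    (P (alpha v') <= P (alpha c))%N & (toint v < toint v')%R].
Proof.
move=> cs pc tc.
have [|k [pk kc]] := @ascent subscript_at p (P (alpha c)) pc.
  by rewrite -{1}Pt !subscript_at_pos.
have [|v Pv] := @run_alpha k pk; first by lia.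
have [||v' Pv'] := @run_alpha k.+1; try lia.
rewrite -Pv' -{1}Pv !subscript_at_pos => vv'.
by exists v, v'; split=> //; lia.
Qed.

(** If alpha (neg s) lies between alpha t and alpha s in u, it is just before
    alpha s and is the n-th alpha-letter by [middle]; it is then too early to
    follow the beta-letter of an ascent. Otherwise all the letters of the run
    have the sign of s, and alpha (neg s) follows beta v at an ascent v, v'.
    If v' = s, then beta v, alpha (neg s), beta s are in the middle of the
    word and [cond_beta_beta] applies. If not, alpha (neg v') is opposed both
    to beta v, which it follows, and to beta s, which it precedes; but beta s
    comes before beta v in w. *)
Lemma first_diff_alpha_alpha : False.
Proof.
have ps := first_diff_lt.
have sign c : (p <= P (alpha c))%N -> (P (alpha c) <= P (alpha s))%N ->
   c <> neg s -> c.1 = s.1.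
  move=> pc; rewrite leq_eqVlt => /orP[/eqP/(pos_eq sku)[_ ->]//|cs] ne.
  by case: (run_sign pc cs).
have [/andP[h1 h2]|none] := boolP ((p <= P (alpha (neg s))) && (P (alpha (neg s)) < P (alpha s)))%N.
  have [s1 adj [e [ec third]]] := run_middle h1 h2.
  have t1 : t.1 = s.1.
    apply: sign; rewrite ?Pt //; first by lia.
    move=> e'; move: lt_ts; rewrite e' toint_neg; have := toint_sign s.
    by move: s1; case: (s.1) => //; lia.
  have pe : (p <= P (alpha e))%N.
    suff : P (alpha t) <> P (alpha (neg s)) by lia.
    by move=> /(pos_eq sku)[_ e']; move: t1; rewrite e' /=; case: (s.1).
  have e1 : e.1 = s.1.
    apply: sign => //; first by lia.
    by move=> e'; move: ec; rewrite e'; lia.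
  have late v : (p <= P (alpha v))%N -> P (alpha (neg s)) = (P (beta v)).+1 -> False.
    by move=> /run_beta_after; lia.
  have [te|et] := ltP (toint t) (toint e).
    have [|v [v' [pv adj' v'e vv']]] := @run_exists_ascent e _ pe te; first by lia.
    have [] := @ascent_next_alpha v v' pv adj'; try lia; last by move/(late v pv).
    - by apply: sign => // [|e']; [lia|move: adj'; rewrite e'; lia].
    - by apply: sign => // [||e']; [lia|lia|move: v'e; rewrite e'; lia].
  (* There is no ascent from t to e, so that e <= t < s, and the last clause
     of the condition on the middle letters separates beta e from
     beta (neg s). *)
  have ne : P (beta (neg s)) <> (P (beta e)).+1.
    by rewrite e1 in third; move/(third s1); lia.
  have [] := @next_alpha_neg e (neg s) pe _ e1 ec ne; try lia.
  - by apply: ltnW; rewrite (beta_mono sku).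
  - by move/(late e pe).
have sign' c : (p <= P (alpha c))%N -> (P (alpha c) <= P (alpha s))%N -> c.1 = s.1.
  move=> pc cs; apply: sign => // e; move: none; rewrite -e pc /= -leqNgt => sc.
  have /(pos_eq sku)[_ ecs] : P (alpha c) = P (alpha s) by lia.
  by move/eqP: e; rewrite ecs neq_neg.
have [|v [v' [pv adj v's vv']]] := run_exists_ascent (leqnn _) _ lt_ts; first by lia.
have v1 : v.1 = s.1 by apply: sign'; lia.
have v1' : v'.1 = s.1 by apply: sign'; lia.
have [Ps Psv'] := ascent_next_alpha pv adj v's v1 v1' vv'.
have mono := @beta_mono _ _ sku.
have [e|ne] := eqVneq v' s.
  subst v'.
  (* A letter between these two conjugates, or its own conjugate, would be a
     beta-letter between beta v and beta s. *)
  have Pss : P (beta s) = (P (alpha (neg s))).+1.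
    apply/eqP; rewrite eqn_leq Psv' andbT leqNgt; apply/negP => gap.
    have kn : ((P (alpha (neg s))).+1 < 4 * n)%N.
      by have := pos_lt_size (beta s) (sk_uniq sku); lia.
    have [[] [f Pf]] := pos_surj (sk_uniq sku) kn; last first.
      by have := mono v f; have := mono f s; lia.
    have := pos_neg sku true f; have := pos_neg sku false s => /=.
    by have := mono v (neg f); have := mono (neg f) s; lia.
  have := pos_neg sku false s => /= ss.
  have : (toint s < toint v)%R by apply: (cond_beta_beta gu) => //; lia.
  by lia.
have Pv's : (P (alpha v') < P (alpha s))%N.
  have : P (alpha v') <> P (alpha s) by move=> /(pos_eq sku)[_ /eqP]; rewrite (negbTE ne).
  by lia.
have := pos_neg sku true v'; have := pos_neg sku true s.
have := pos_neg sku false v'; have := pos_neg sku false s => /= *.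
have Qs' : (Q (alpha (neg v')) < Q (beta s))%N.
  rewrite -sameE; first by lia.
  rewrite /opposed /= v1'; apply/andP; split; first by case: (s.1).
  by apply/eqP => e2; move/eqP: ne; apply; apply: eq_signed.
have Qv : (Q (beta s) < Q (beta v))%N.
  rewrite (beta_mono skw) Qs; apply: run_after => //.
  by move=> /lett_inj [_ e]; move: adj v's; rewrite e; lia.
have : (Q (beta v) < Q (alpha (neg v')))%N.
  rewrite -sameE; first by have := alpha_neg sku v' s; lia.
  rewrite /opposed /= v1 v1'; apply/andP; split; first by case: (s.1).
  by apply/eqP => e2; move: adj; rewrite (@eq_signed _ v v' _ e2) ?v1 //; lia.
lia.
Qed.

End AlphaAlpha.

End Core.

(** At the first difference the two words cannot both have beta-letters:
    beta-letters come in the order of their alpha-letters, so a common prefix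
    determines the next one. *)
Lemma conditions_maximal u w : sketch u -> sketch w -> pos_conditions u ->
  same_class u w -> u != w ->
  word_lt w u.
Proof.
move=> sku skw gu same ne; have uu := sk_uniq sku; have uw := sk_uniq skw.
have /orP[|//] := word_lt_total uu uw ne.
case/(word_ltP uu uw) => x [y []]; rewrite -(lett_kind x) -(lett_kind y).
move: (kind x) (kind y) x.1 y.1 => k k' t s Qs; rewrite letter_key_lt => lt_k agr.
case/orP: lt_k => [/andP[]|/andP[/eqP e lt_ts]].
  case: k k' Qs agr => [] [] // Qs agr _ _.
  by case: (first_diff_alpha_beta sku skw gu same agr Qs erefl).
case: k e Qs agr => <- Qs agr.
  by case: (first_diff_alpha_alpha sku skw gu same agr Qs erefl lt_ts).
have abt := sk_alpha_beta sku t; have abs := sk_alpha_beta skw s.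
have at_ := agr _ abt; have as_ := agreeP sku skw agr.
have := as_ (alpha s); rewrite -Qs => /(_ abs) as'.
have nests : t <> s by move=> e; move: lt_ts; rewrite e ltxx.
have h1 : pos w (beta t) <> pos w (beta s) by move/(pos_eq skw)=> [].
have h2 : pos u (beta t) <> pos u (beta s) by move/(pos_eq sku)=> [].
have h3 : ~~ (pos w (beta t) < pos w (beta s))%N.
  by apply/negP; rewrite Qs => /(agreeP sku skw agr); lia.
have h4 : ~~ (pos u (beta s) < pos u (beta t))%N.
  by apply/negP => /agr; rewrite Qs; lia.
have := beta_mono sku s t; have := beta_mono skw s t; lia.
Qed.

End Conditions.

(** * Moves that enlarge a sketch within its class *)

Section Moves.
Variable n : nat.
Implicit Types (w u : word n) (s t : signed n).

(** This lets words be constructed by prescribing the positions of their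
    letters. *)
Lemma word_of_pos (f : letter n -> nat) : injective f ->
  (forall x, (f x < 4 * n)%N) -> exists w, uniq w /\ forall x, pos w x = f x.
Proof.
move=> finj fn; pose g x := Ordinal (fn x).
have ginj : injective g by move=> x y /(congr1 val) /finj.
have [h gh hg] : bijective g by apply: inj_card_bij; rewrite // card_letter card_ord.
exists [tuple h i | i < 4 * n]; set w := mktuple _.
have uw : uniq w by rewrite map_inj_uniq ?enum_uniq //; apply: can_inj hg.
split=> // x; have <- : tnth w (g x) = x by rewrite tnth_mktuple gh.
by rewrite pos_tnth // tnth_mktuple gh.
Qed.

Lemma pos_neg_lt w k l s t : sketch w ->
  (pos w (lett k s) < pos w (lett l t))%N ->
  (pos w (lett k (neg t)) < pos w (lett l (neg s)))%N.
Proof.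
move=> skw; have := pos_neg skw k s; have := pos_neg skw l t.
case: k l => [] [] /=; try lia; first by rewrite (alpha_neg skw).
by rewrite !(beta_mono skw) (alpha_neg skw).
Qed.

(** The adjacent transposition at p together with its mirror image at r. They
    coincide when p = r, that is at the centre of the word. *)
Definition swap_pos (p r k : nat) : nat :=
  if k == p then p.+1 else if k == p.+1 then p else
  if k == r then r.+1 else if k == r.+1 then r else k.

Lemma swap_posK p r N : (p + r).+2 = (4 * N)%N -> involutive (swap_pos p r).
Proof.
move=> pr k; rewrite /swap_pos.
have [->|] := eqVneq k p; first by do !case: eqP; lia.
have [->|] := eqVneq k p.+1; first by do !case: eqP; lia.
have [->|] := eqVneq k r; first by do !case: eqP; lia.
have [->|] := eqVneq k r.+1; first by do !case: eqP; lia.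
by do !case: eqP; lia.
Qed.

(** Apart from the swapped pair and its mirror image, no two letters change
    their relative order; in particular the order of the alpha-letters and that
    of the beta-letters are preserved. *)
Lemma swap_beta_alpha w s t : sketch w ->
  pos w (alpha t) = (pos w (beta s)).+1 -> ~~ opposed (beta s) (alpha t) ->
  exists w', [/\ sketch w', same_class w w' &
    forall x, pos w' x = swap_pos (pos w (beta s)) (pos w (beta (neg t))) (pos w x)].
Proof.
move=> skw adj nop; set p := pos w (beta s); set r := pos w (beta (neg t)).
have uw := sk_uniq skw.
have pr : (p + r).+2 = (4 * n)%N by have := pos_neg skw true t; rewrite adj /=; lia.
have As : pos w (alpha (neg s)) = r.+1.
  by have := pos_neg skw false s; rewrite /=; lia.
have swapK := swap_posK pr.
have [x|x|w' [uw' posw']] := @word_of_pos (fun x => swap_pos p r (pos w x)).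
- by move=> y /(congr1 (swap_pos p r)); rewrite !swapK => /(pos_inj uw).
- by have := pos_lt_size x uw; rewrite /swap_pos; do !case: eqP; lia.
have order x y : (pos w x < pos w y)%N -> (pos w' x < pos w' y)%N \/
    (x = beta s /\ y = alpha t) \/ (x = beta (neg t) /\ y = alpha (neg s)).
  move=> xy; have [e|ne] := eqVneq (pos w x, pos w y) (p, p.+1).
    move: e => [/(pos_inj uw) -> e]; right; left; split=> //.
    by apply: (pos_inj uw); rewrite adj.
  have [e|ne'] := eqVneq (pos w x, pos w y) (r, r.+1).
    move: e => [/(pos_inj uw) -> e]; right; right; split=> //.
    by apply: (pos_inj uw); rewrite As.
  by left; move: ne ne'; rewrite !posw' /swap_pos !xpair_eqE; do !case: eqP; lia.
have alpha_order a b :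
    (pos w (alpha a) < pos w (alpha b))%N = (pos w' (alpha a) < pos w' (alpha b))%N.
  apply/idP/idP.
    by case/order => [//|[[/lett_inj[]]|[/lett_inj[]]]].
  have [//|/order|/(pos_inj uw) ->] := ltngtP (pos w (alpha a)) (pos w (alpha b)).
    by case=> [|[[/lett_inj[]]|[/lett_inj[]]]] //; lia.
  by rewrite ltnn.
exists w'; split=> //; first split=> //.
- by move=> a; case: (order _ _ (sk_alpha_beta skw a)) => [//|[[/lett_inj[]]|[/lett_inj[]]]].
- move=> a b; rewrite -alpha_order => /(sk_mono skw)/order.
  by case=> [//|[[_ /lett_inj[]]|[_ /lett_inj[]]]].
- move=> a; have := pos_neg skw true a => /=; rewrite !posw' /swap_pos; do !case: eqP; lia.
move=> x y oxy /order [//|[[ex ey]|[ex ey]]]; first by rewrite -ex -ey oxy in nop.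
move: oxy nop; rewrite ex ey /opposed /=.
by rewrite eq_sym [X in _ && ~~ X]eq_sym; case: (s.1) (t.1) => [] [] ->.
Qed.

(** The axioms of sketches are invariant under signed permutations of the
    subscripts; restricting to involutions spares the inverse. *)
Lemma relabel (sigma : signed n -> signed n) w : sketch w ->
  involutive sigma -> (forall x, sigma (neg x) = neg (sigma x)) ->
  exists w', sketch w' /\ forall k x, pos w' (lett k x) = pos w (lett k (sigma x)).
Proof.
move=> skw sigK sigN; have uw := sk_uniq skw.
have [x y|x|w' [uw' posw']] := @word_of_pos (fun x => pos w (lett (kind x) (sigma x.1))).
- move/(pos_inj uw)/lett_inj => [ek /(inv_inj sigK) es].
  by rewrite -(lett_kind x) -(lett_kind y) ek es.
- exact: pos_lt_size.
have posE k x : pos w' (lett k x) = pos w (lett k (sigma x)).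
  by rewrite posw' kind_lett.
exists w'; split=> //; split=> // [x|x y|x]; rewrite !posE.
- exact: (sk_alpha_beta skw).
- exact: (sk_mono skw).
- by rewrite sigN (sk_conj skw).
Qed.

Definition exchange (i j : 'I_n) (x : signed n) : signed n := (x.1, tperm i j x.2).

Lemma exchange_id i j x : x.2 != i -> x.2 != j -> exchange i j x = x.
Proof. by case: x => b k /= ki kj; rewrite /exchange tpermD // eq_sym. Qed.

(** The hypothesis takes care of the opposed pairs of which one letter is
    moved. An opposed pair of two moved letters, with subscripts a and b, is
    sent to subscripts neg b and neg a, and exchanging negated subscripts
    preserves the order in every sketch. *)
Lemma relabel_exchange w s t : sketch w -> s.1 = t.1 -> s.2 != t.2 ->
  (forall k y, y.1.1 != s.1 -> y.1.2 != s.2 -> y.1.2 != t.2 ->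
    (pos w (lett k s) < pos w y)%N = (pos w (lett k t) < pos w y)%N) ->
  exists w', [/\ sketch w', same_class w w' &
    forall k x, pos w' (lett k x) = pos w (lett k (exchange s.2 t.2 x))].
Proof.
move=> skw e1 ne2 st; have uw := sk_uniq skw.
have [x|x|w' [skw' posw']] := @relabel (exchange s.2 t.2) w skw.
- by case: x => b k; rewrite /exchange tpermK.
- by [].
exists w'; split=> //.
have ex_s : exchange s.2 t.2 s = t.
  by rewrite /exchange tpermL e1; case: (t).
have ex_t : exchange s.2 t.2 t = s.
  by rewrite /exchange tpermR -e1; case: (s).
have st' k y : y.1.1 != s.1 -> y.1.2 != s.2 -> y.1.2 != t.2 ->
    (pos w y < pos w (lett k s))%N = (pos w y < pos w (lett k t))%N.
  move=> y1 ys yt; have := st k y y1 ys yt.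
  have : pos w y <> pos w (lett k s) by move/(pos_inj uw)=> e; rewrite e eqxx in ys.
  have : pos w y <> pos w (lett k t) by move/(pos_inj uw)=> e; rewrite e eqxx in yt.
  by lia.
have conj_lt m l x z : (pos w (lett m (neg x)) < pos w (lett l z))%N =
    (pos w (lett (~~ l) (neg z)) < pos w (lett (~~ m) x))%N.
  by have := pos_neg skw m (neg x); have := pos_neg skw l z; rewrite negK; lia.
have moved k a y : a.1 != y.1.1 -> y.1.2 != s.2 -> y.1.2 != t.2 ->
    (pos w (lett k (exchange s.2 t.2 a)) < pos w y)%N = (pos w (lett k a) < pos w y)%N.
  rewrite -(lett_kind y); move: (kind y) y.1 => l {}y /= ay ys yt.
  have [i_s|nis] := eqVneq a.2 s.2.
    have [|] := eq_or_neg i_s => ea; subst a.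
      by rewrite ex_s st // eq_sym.
    rewrite -[exchange _ _ _]/(neg (exchange s.2 t.2 s)) ex_s.
    rewrite (conj_lt k l t y) (conj_lt k l s y) st' //=.
    by move: ay => /=; case: (s.1) (y.1) => [] [].
  have [i_t|nit] := eqVneq a.2 t.2; last by rewrite exchange_id.
  have [|] := eq_or_neg i_t => ea; subst a.
    by rewrite ex_t st // eq_sym e1.
  rewrite -[exchange _ _ _]/(neg (exchange s.2 t.2 t)) ex_t.
  rewrite (conj_lt k l s y) (conj_lt k l t y) st' //=.
  by move: ay; rewrite /= -e1; case: (s.1) (y.1) => [] [].
have moved' k a y : a.1 != y.1.1 -> a.2 != y.1.2 -> y.1.2 != s.2 -> y.1.2 != t.2 ->
    (pos w y < pos w (lett k (exchange s.2 t.2 a)))%N = (pos w y < pos w (lett k a))%N.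
  move=> a1 a2 ys yt; have := moved k a y a1 ys yt.
  have : pos w y <> pos w (lett k a) by move/(pos_inj uw)=> e; rewrite e eqxx in a2.
  have : pos w y <> pos w (lett k (exchange s.2 t.2 a)).
    move/(pos_inj uw) => e; move: ys yt a2; rewrite e /=.
    by case: tpermP => [->|->|]; rewrite ?eqxx // => _ _ ; rewrite eqxx.
  by lia.
move=> x y; rewrite -(lett_kind x) -(lett_kind y).
move: (kind x) (kind y) x.1 y.1 => k l {}x {}y /andP[/= xy1 xy2]; rewrite !posw'.
have [/andP[xs xt]|nx] := boolP ((x.2 != s.2) && (x.2 != t.2)).
  rewrite (exchange_id xs xt) moved' 1?eq_sym // 1?eq_sym //.
have [/andP[ys yt]|ny] := boolP ((y.2 != s.2) && (y.2 != t.2)).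
  by rewrite (exchange_id ys yt) moved.
have [-> ->] : exchange s.2 t.2 x = neg y /\ exchange s.2 t.2 y = neg x.
  have ny1 : x.1 = ~~ y.1 by move: xy1; case: (x.1) (y.1) => [] [].
  have nx1 : y.1 = ~~ x.1 by rewrite ny1 negbK.
  rewrite /exchange /neg -ny1 -nx1.
  move: nx ny xy2; rewrite !negb_and !negbK.
  by case/orP => /eqP -> /orP [] /eqP ->; rewrite ?eqxx // ?tpermL ?tpermR.
exact: pos_neg_lt.
Qed.

Lemma same_class_trans u v w : same_class u v -> same_class v w -> same_class u w.
Proof. by move=> uv vw x y o /(uv _ _ o)/(vw _ _ o). Qed.

Definition flip (i : 'I_n) (x : signed n) : signed n := (x.1 (+) (x.2 == i), x.2).

Lemma flip_id i x : x.2 != i -> flip i x = x.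
Proof. by case: x => b k /= /negbTE ki; rewrite /flip /= ki addbF. Qed.

Lemma flip_self c : flip c.2 c = neg c.
Proof. by case: c => b i; rewrite /flip /neg /= eqxx addbT. Qed.

Lemma flip_neg c : flip c.2 (neg c) = c.
Proof. by case: c => b i; rewrite /flip /neg /= eqxx addbT negbK. Qed.

Lemma beta_adjacent_neg w c : sketch w -> pos w (alpha (neg c)) = (pos w (alpha c)).+1 ->
  pos w (beta (neg c)) = (pos w (beta c)).+1.
Proof.
move=> skw adj; have := pos_neg skw true c; have := pos_neg skw false c => /=; lia.
Qed.

(** The beta-letters of c and neg c are adjacent as well, by symmetry, so no
    third letter separates what the flip exchanges. *)
Lemma relabel_flip w c : sketch w -> pos w (alpha (neg c)) = (pos w (alpha c)).+1 ->
  exists w', [/\ sketch w', same_class w w' &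
    forall k x, pos w' (lett k x) = pos w (lett k (flip c.2 x))].
Proof.
move=> skw adj; have adjb := beta_adjacent_neg skw adj; have uw := sk_uniq skw.
have [x|x|w' [skw' posw']] := @relabel (flip c.2) w skw.
- by case: x => b k; rewrite /flip /= -addbA addbb addbF.
- by case: x => b k; rewrite /flip /neg /= addNb.
exists w'; split=> //.
have away k d y : d.2 = c.2 -> y.1.2 != c.2 -> pos w y <> pos w (lett k d).
  by move=> dc yc /(pos_inj uw) e; rewrite e /= dc eqxx in yc.
have close k y : y.1.2 != c.2 ->
    (pos w y < pos w (lett k c))%N = (pos w y < pos w (lett k (neg c)))%N
    /\ (pos w (lett k c) < pos w y)%N = (pos w (lett k (neg c)) < pos w y)%N.
  move=> yc; have := away k c y erefl yc; have := away k (neg c) y erefl yc.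
  by case: k => *; lia.
move=> x y; rewrite -(lett_kind x) -(lett_kind y).
move: (kind x) (kind y) x.1 y.1 => k l {}x {}y /andP[/= xy1 xy2]; rewrite !posw'.
have [xc|xc] := eqVneq x.2 c.2.
  have yc : y.2 != c.2 by rewrite -xc eq_sym.
  rewrite (flip_id yc); have [_] := @close k (lett l y) yc.
  by case: (eq_or_neg xc) => ->; rewrite ?flip_self ?flip_neg => ->.
rewrite (flip_id xc).
have [yc|yc] := eqVneq y.2 c.2; last by rewrite flip_id.
have [+ _] := @close l (lett k x) xc.
by case: (eq_or_neg yc) => ->; rewrite ?flip_self ?flip_neg => ->.
Qed.

Section Maximal.
Variable w : word n.
Hypothesis n2 : (2 <= n)%N.
Hypothesis skw : sketch w.
Hypothesis wmax : forall u, sketch u -> same_class w u -> ~~ word_lt w u.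

(** The form in which maximality is contradicted: a sketch u of the class that
    first differs from w at the letter x and has a larger letter y there. *)
Lemma no_better u x y : sketch u -> same_class w u ->
  (forall k z, (pos w (lett k z) < pos w x)%N -> pos u (lett k z) = pos w (lett k z)) ->
  pos u y = pos w x -> (letter_key x < letter_key y)%O -> False.
Proof.
move=> sku wu agr yx xy; move/negP: (wmax sku wu); apply.
apply: word_lt_at xy => //; try exact: sk_uniq.
by move=> z; rewrite -(lett_kind z); apply: agr.
Qed.

Lemma maximal_beta_alpha s t : pos w (alpha t) = (pos w (beta s)).+1 -> opposed (beta s) (alpha t).
Proof.
move=> adj; apply/negPn/negP => nop.
have [w' [skw' ww' posw']] := swap_beta_alpha skw adj nop.
have := pos_neg skw true t; have := pos_neg skw false s => /= es et.
have [pr|rp] := leqP (pos w (beta s)) (pos w (beta (neg t))).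
  apply: (@no_better w' (beta s) (alpha t)) => //; last by rewrite letter_key_lt.
    by move=> k z; rewrite posw' /swap_pos; do !case: eqP; lia.
  by rewrite posw' adj /swap_pos; do !case: eqP; lia.
apply: (@no_better w' (beta (neg t)) (alpha (neg s))) => //; last by rewrite letter_key_lt.
  by move=> k z; rewrite posw' /swap_pos; do !case: eqP; lia.
by rewrite posw' /swap_pos; do !case: eqP; lia.
Qed.

(** The first letter that the exchange moves is alpha s or alpha (neg t); it
    is replaced by alpha t or alpha (neg s), which is larger in either case
    when s < t. *)
Lemma maximal_exchange s t : s.1 = t.1 -> (pos w (alpha s) < pos w (alpha t))%N ->
  (forall k y, y.1.1 != s.1 -> y.1.2 != s.2 -> y.1.2 != t.2 ->
    (pos w (lett k s) < pos w y)%N = (pos w (lett k t) < pos w y)%N) ->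
  (toint t < toint s)%R.
Proof.
move=> e1 ast st.
have [//|lt_st|/toint_inj e] := ltgtP (toint t) (toint s); last by rewrite e ltnn in ast.
exfalso; have ne2 : s.2 != t.2.
  by apply/eqP => /(eq_signed e1) e; rewrite e ltxx in lt_st.
have [w' [skw' ww' posw']] := relabel_exchange skw e1 ne2 st.
have ex_s : exchange s.2 t.2 s = t by rewrite /exchange tpermL e1; case: (t).
have ex_t : exchange s.2 t.2 t = s by rewrite /exchange tpermR -e1; case: (s).
have nst := alpha_neg skw s t.
have above k z : (pos w (alpha z) <= pos w (lett k z))%N.
  by case: k => //; rewrite ltnW ?(sk_alpha_beta skw).
have fixed k z m : (m <= pos w (alpha s))%N -> (m <= pos w (alpha (neg t)))%N ->
    (pos w (lett k z) < m)%N -> pos w' (lett k z) = pos w (lett k z).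
  move=> ms mt zm; rewrite posw' exchange_id //; apply/eqP => /eq_or_neg [] e; subst z;
    by move: zm; rewrite ltnNge; apply/negP/negPn; apply: leq_trans (above k _); lia.
have [lt_s|lt_t] := leqP (pos w (alpha s)) (pos w (alpha (neg t))).
  apply: (@no_better w' (alpha s) (alpha t)) => //; last by rewrite letter_key_lt.
    by move=> k z; apply: fixed.
  by rewrite posw' ex_t.
apply: (@no_better w' (alpha (neg t)) (alpha (neg s))) => //.
- by move=> k z; apply: fixed => //; apply: ltnW.
- by rewrite posw' -[exchange _ _ _]/(neg (exchange s.2 t.2 s)) ex_s.
by rewrite letter_key_lt /= !toint_neg ltrN2.
Qed.

Lemma maximal_middle_sign c : pos w (alpha (neg c)) = (pos w (alpha c)).+1 -> c.1.
Proof.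
move=> adj; apply/negPn/negP => c1.
have [w' [skw' ww' posw']] := relabel_flip skw adj.
apply: (@no_better w' (alpha c) (alpha (neg c))) => //.
- move=> k z zc; rewrite posw' flip_id //; apply/eqP => /eq_or_neg [] e; subst z.
    by have := sk_alpha_beta skw c; case: k zc; lia.
  by have := sk_alpha_beta skw (neg c); case: k zc; lia.
- by rewrite posw' flip_neg.
rewrite letter_key_lt /= toint_neg.
have nc : (0 < toint (neg c))%R by rewrite toint_sign.
by move: nc; rewrite toint_neg; lia.
Qed.

(** If a letter beta v preceded alpha c, it would be opposed to it, so
    flipping c would make it a letter of the same sign as the
    following alpha (neg c). Swapping these two then puts an alpha-letter in
    the place of beta v, ahead of the places affected by the flip. *)
Lemma maximal_middle_prev c : pos w (alpha (neg c)) = (pos w (alpha c)).+1 ->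
  exists e, pos w (alpha c) = (pos w (alpha e)).+1.
Proof.
move=> adj; have uw := sk_uniq skw.
have [d dc] : exists d : signed n, d.2 != c.2.
  have n0 : (0 < n)%N by lia.
  (* A second mod-value exists because n is at least 2; by symmetry one of its
     two alpha-letters precedes alpha c, which is thus not the first letter. *)
  have [e|e] := eqVneq c.2 (Ordinal n0).
    by exists (true, Ordinal n2); rewrite e.
  by exists (true, Ordinal n0); rewrite eq_sym.
have c_pos : (0 < pos w (alpha c))%N.
  have ne k a : a.2 = d.2 -> pos w (alpha a) <> pos w (alpha (if k then c else neg c)).
    by move=> ad /(pos_eq skw)[_ e]; move: dc; rewrite -ad e; case: (k); rewrite eqxx.
  have := alpha_neg skw c d.
  have := ne true d erefl; have := ne false d erefl.
  have := ne true (neg d) erefl; have := ne false (neg d) erefl; lia.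
have kn : ((pos w (alpha c)).-1 < 4 * n)%N.
  by have := pos_lt_size (alpha c) uw; lia.
have [[] [v Pv]] := pos_surj uw kn; first by exists v; lia.
exfalso; have adjv : pos w (alpha c) = (pos w (beta v)).+1 by lia.
have ovc := maximal_beta_alpha adjv.
have [w1 [skw1 ww1 posw1]] := relabel_flip skw adj.
have v2 : v.2 != c.2 by move: ovc; rewrite /opposed => /andP[].
have adj1 : pos w1 (alpha (neg c)) = (pos w1 (beta v)).+1.
  by rewrite !posw1 flip_neg flip_id.
have nop1 : ~~ opposed (beta v) (alpha (neg c)).
  by move: ovc; rewrite /opposed /=; case: (v.1) (c.1) => [] [].
have [w2 [skw2 w12 posw2]] := swap_beta_alpha skw1 adj1 nop1.
move: posw2; rewrite negK !posw1 flip_self (flip_id v2) => posw2.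
have := sk_alpha_beta skw (neg c) => abc.
apply: (@no_better w2 (beta v) (alpha (neg c))) => //; last by rewrite letter_key_lt.
- exact: same_class_trans ww1 w12.
- move=> k z zv; have zc : z.2 != c.2.
    apply/eqP => /eq_or_neg [] e; subst z.
      by have := sk_alpha_beta skw c; case: k zv; lia.
    by case: k zv; lia.
  by rewrite posw2 posw1 flip_id // /swap_pos; do !case: eqP; lia.
by rewrite posw2 posw1 flip_neg adjv /swap_pos; do !case: eqP; lia.
Qed.

(** A flip of c brings alpha (neg c) next to alpha e, and exchanging
    e with neg c puts it in the place of alpha e. *)
Lemma maximal_middle_sub c e : pos w (alpha (neg c)) = (pos w (alpha c)).+1 ->
  pos w (alpha c) = (pos w (alpha e)).+1 -> ~~ e.1 ->
  pos w (beta c) = (pos w (beta e)).+1 -> (toint (neg c) < toint e)%R.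
Proof.
move=> adj adje e1 adjb; have c1 := maximal_middle_sign adj.
have ec2 : e.2 != c.2.
  by apply/eqP => /eq_or_neg [] ec; subst e; move: adje; lia.
have [//|lt_st|/toint_inj ee] := ltgtP (toint (neg c)) (toint e); last by subst e; lia.
exfalso; have [w1 [skw1 ww1 posw1]] := relabel_flip skw adj.
have ec1 : e.1 = (neg c).1 by rewrite /= c1 (negbTE e1).
have [k y _ y1 y2|w2 [skw2 w12 posw2]] := relabel_exchange skw1 ec1 ec2.
  rewrite !posw1 flip_neg (flip_id ec2) -(lett_kind y) posw1 flip_id //.
  have ye : pos w (lett (kind y) y.1) <> pos w (lett k e).
    by move/(pos_eq skw) => [_ e']; rewrite e' eqxx in y1.
  have yc : pos w (lett (kind y) y.1) <> pos w (lett k c).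
    by move/(pos_eq skw) => [_ e']; rewrite e' eqxx in y2.
  by move: (pos w (lett (kind y) y.1)) ye yc => m; case: k; lia.
have ex_c : exchange e.2 c.2 (neg c) = e.
  by rewrite /exchange tpermR -ec1; case: (e).
apply: (@no_better w2 (alpha e) (alpha (neg c))) => //; last by rewrite letter_key_lt.
- exact: same_class_trans ww1 w12.
- move=> k z ze; have nec := alpha_neg skw e c.
  have above z' : (pos w (alpha z') <= pos w (lett k z'))%N.
    by case: (k) => //; rewrite ltnW ?(sk_alpha_beta skw).
  have zc : z.2 != c.2.
    by apply/eqP => /eq_or_neg [] e'; subst z; have := above c; have := above (neg c); lia.
  have ze2 : z.2 != e.2.
    by apply/eqP => /eq_or_neg [] e'; subst z; have := above e; have := above (neg e); lia.
  by rewrite posw2 exchange_id // posw1 flip_id.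
by rewrite posw2 ex_c posw1 flip_id.
Qed.

Lemma maximal_conditions : pos_conditions w.
Proof.
split.
- exact: maximal_beta_alpha.
- move=> s t adja adjb e1; apply: maximal_exchange => //; first by lia.
  move=> k y _ ys yt.
  have ye : pos w y <> pos w (lett k s).
    by move/(pos_inj (sk_uniq skw)) => e; rewrite e eqxx in ys.
  have yc : pos w y <> pos w (lett k t).
    by move/(pos_inj (sk_uniq skw)) => e; rewrite e eqxx in yt.
  by case: k ye yc; lia.
- move=> c adj; split; first exact: maximal_middle_sign adj.
  have [e ec] := maximal_middle_prev adj; exists e; split=> //.
  exact: maximal_middle_sub.
move=> s t bs bt e1 adja; apply: maximal_exchange => //; first by lia.
move=> k y _ ys yt.
have ye l : pos w y <> pos w (lett l s).
  by move/(pos_inj (sk_uniq skw)) => e; rewrite e eqxx in ys.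
have yc l : pos w y <> pos w (lett l t).
  by move/(pos_inj (sk_uniq skw)) => e; rewrite e eqxx in yt.
have ync : pos w y <> pos w (alpha (neg t)).
  by move/(pos_inj (sk_uniq skw)) => e; rewrite e eqxx in yt.
have := pos_neg skw false t => /=.
by case: k (ye k) (yc k); lia.
Qed.

End Maximal.

End Moves.

(** * Ranks among the alpha-letters *)

Section Ranks.
Variable n : nat.
Implicit Types (s t : signed n).

Lemma index_filter (T : eqType) (P : pred T) (r : seq T) x : P x -> x \in r ->
  index x (seq.filter P r) = count P (take (index x r) r).
Proof.
move=> Px; elim: r => //= y r IHr; rewrite inE eq_sym.
have [->|ne /= xr] := eqVneq y x; first by rewrite Px /= eqxx.
by case: (P y) => /=; rewrite ?(negbTE ne) IHr.
Qed.

Lemma onth_uniq (T : eqType) (r : seq T) k x : uniq r ->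
  onth r k = Some x <-> x \in r /\ index x r = k.
Proof.
move=> ur; split=> [e|[xr <-]].
  have kr : (k < size r)%N by rewrite -onthTE e.
  have <- := onth_nth x _ _ _ e; by rewrite mem_nth // index_uniq.
have := onthTE r (index x r); rewrite index_mem xr.
by case e: (onth r _) => [y|//] _; rewrite -(onth_nth x _ _ _ e) nth_index.
Qed.

Variable w : word n.
Hypothesis skw : sketch w.

Definition rank s := #|[set t : signed n | (pos w (alpha t) < pos w (alpha s))%N]%SET|.

Lemma count_kind k s :
  count (fun x => kind x == k) (take (pos w (lett k s)) w) = rank s.
Proof.
have uw := sk_uniq skw; set i := pos _ _.
rewrite -size_filter /rank -(card_imset _ (fun s t (e : lett k s = lett k t) => (lett_inj e).2)).
rewrite -(card_uniqP (filter_uniq _ (take_uniq _ uw))); apply: eq_card => x.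
rewrite mem_filter in_take ?wordP //; apply/andP/imsetP => [[/eqP xk xi]|[t + ->]].
  exists x.1; last by rewrite -xk lett_kind.
  move: xi; rewrite inE -{1}[x]lett_kind xk /i.
  by case: (k); rewrite // -(beta_mono skw).
rewrite inE kind_lett; split=> //; rewrite -/(pos w _) /i.
by case: (k); rewrite // (beta_mono skw).
Qed.

Lemma kth_kind k j x :
  kth (seq.filter (fun x => kind x == k) w) j x <-> exists s, x = lett k s /\ (rank s).+1 = j.
Proof.
have uw := sk_uniq skw; rewrite /kth /=.
case: j => [|j] /=; first by split=> [[]|[s []]].
split=> [[_ /(onth_uniq _ _ (filter_uniq _ uw))]|[s [-> [rs]]]].
  rewrite mem_filter => -[/andP[xk xw]]; rewrite index_filter // => <-.
  exists x.1; have ex : x = lett k x.1 by rewrite -(eqP xk) lett_kind.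
  by rewrite -(count_kind k) -ex.
split=> //; apply/(onth_uniq _ _ (filter_uniq _ uw)).
rewrite mem_filter kind_lett eqxx wordP //; split=> //.
by rewrite index_filter ?kind_lett ?wordP //; rewrite -rs -(count_kind k).
Qed.

Lemma kth_alphas j x : kth (alphas w) j x <-> exists s, x = alpha s /\ (rank s).+1 = j.
Proof.
rewrite -kth_kind /alphas.
have -> // : [seq x <- w | is_alpha x] = [seq x <- w | kind x == true].
by apply: eq_filter => y; rewrite is_alphaE eqb_id.
Qed.

Lemma kth_betas j x : kth (betas w) j x <-> exists s, x = beta s /\ (rank s).+1 = j.
Proof.
rewrite -kth_kind /betas.
have -> // : [seq x <- w | is_beta x] = [seq x <- w | kind x == false].
by apply: eq_filter => y; rewrite is_betaE eqbF_neg.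
Qed.

Lemma kth_word j x : kth w j x <-> (pos w x).+1 = j.
Proof.
rewrite /kth; case: j => [|j] /=; first by split=> [[]|].
split=> [[_ /(onth_uniq _ _ (sk_uniq skw))[_ <-]]//|[e]].
by split=> //; apply/(onth_uniq _ _ (sk_uniq skw)); rewrite wordP ?(sk_uniq skw).
Qed.

Lemma rank_lt s t : (rank s < rank t)%N = (pos w (alpha s) < pos w (alpha t))%N.
Proof.
have mono a b : (pos w (alpha a) < pos w (alpha b))%N -> (rank a < rank b)%N.
  move=> ab; apply/proper_card/properP; split.
    by apply/fintype.subsetP => x; rewrite !inE => /ltn_trans; apply.
  by exists a; rewrite !inE ?ltnn.
apply/idP/idP; last exact: mono.
have [//|/mono|/(pos_eq skw)[_ ->]] := ltngtP (pos w (alpha s)) (pos w (alpha t)).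
  by lia.
by rewrite ltnn.
Qed.

Lemma rank_inj : injective rank.
Proof.
move=> s t e; have := rank_lt s t; have := rank_lt t s; rewrite e ltnn => h1 h2.
have : pos w (alpha s) = pos w (alpha t) by lia.
by move/(pos_eq skw)=> [].
Qed.

Lemma rank_adjacent s t : pos w (alpha t) = (pos w (alpha s)).+1 -> rank t = (rank s).+1.
Proof.
move=> adj; rewrite /rank.
have -> : [set x | (pos w (alpha x) < pos w (alpha t))%N]%SET =
   s |: [set x | (pos w (alpha x) < pos w (alpha s))%N]%SET.
  apply/setP => x; rewrite !inE adj ltnS leq_eqVlt; congr (_ || _).
  by apply/eqP/eqP => [/(pos_eq skw)[]|->].
by rewrite cardsU1 inE ltnn.
Qed.

(** The alpha-letters before that of neg s are the negatives of those after
    that of s. *)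
Lemma rank_neg s : (rank s + rank (neg s)).+1 = (2 * n)%N.
Proof.
have -> : rank (neg s) = #|[set t : signed n | (pos w (alpha s) < pos w (alpha t))%N]%SET|.
  rewrite /rank -(card_imset _ (@neg_inj n)); apply: eq_card => x.
  apply/imsetP/idP => [[z]|]; rewrite !inE => h.
    by move->; rewrite (alpha_negr skw).
  by exists (neg x); rewrite ?negK // inE (alpha_neg skw).
rewrite -card_signed -(cardsC [set t | (pos w (alpha t) < pos w (alpha s))%N]%SET) -addnS.
congr (_ + _)%N; rewrite (cardsD1 s (~: _)) !inE ltnn add1n; congr _.+1.
apply: eq_card => x; rewrite !inE -leqNgt ltn_neqAle; congr (_ && _).
by rewrite eq_sym; congr (~~ _); apply/eqP/eqP => [/(pos_eq skw)[]|->].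
Qed.

Lemma rank_surj k : (k < 2 * n)%N -> exists s, rank s = k.
Proof.
move=> kn; have rn s : (rank s < 2 * n)%N by have := rank_neg s; lia.
have inj : injective (fun s => Ordinal (rn s)) by move=> s t /(congr1 val) /rank_inj.
have [h gh hg] : bijective (fun s => Ordinal (rn s)).
  by apply: inj_card_bij; rewrite // card_signed card_ord.
by exists (h (Ordinal kn)); rewrite -[LHS]/(val (Ordinal (rn _))) hg.
Qed.

Lemma adj_alpha s t : consecutive w (alpha s) (alpha t) -> (rank s < rank t)%N ->
  pos w (alpha t) = (pos w (alpha s)).+1.
Proof. by rewrite rank_lt /consecutive /immediately_before -!/(pos _ _); lia. Qed.

Lemma consecutive_beta s t : (pos w (alpha s) < pos w (alpha t))%N ->
  consecutive w (beta s) (beta t) = (pos w (beta t) == (pos w (beta s)).+1).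
Proof. by rewrite -(beta_mono skw) /consecutive /immediately_before -!/(pos _ _); lia. Qed.

Lemma consecutive_alpha s t : (pos w (beta s) < pos w (beta t))%N ->
  consecutive w (alpha s) (alpha t) = (pos w (alpha t) == (pos w (alpha s)).+1).
Proof. by rewrite (beta_mono skw) /consecutive /immediately_before -!/(pos _ _); lia. Qed.

Lemma positive_lett k s : positive (lett k s) = s.1.
Proof. by []. Qed.

Hypothesis n2 : (2 <= n)%N.

Lemma mod_value_lett k s : mod_value (lett k s) = (s.2).+1.
Proof.
by rewrite /mod_value subscript_lett /toint; case: (s.1); rewrite ?abszN.
Qed.

Lemma opposedE k s l t : opposed (lett k s) (lett l t) =
  (positive (lett k s) != positive (lett l t)) &&
  (mod_value (lett k s) != mod_value (lett l t)).
Proof. by rewrite !mod_value_lett eqSS. Qed.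

Lemma kth_middle c : pos w (alpha (neg c)) = (pos w (alpha c)).+1 ->
  kth (alphas w) n (alpha c) /\ kth (alphas w) (n + 1) (alpha (neg c)).
Proof.
move=> adj; have := rank_adjacent adj; have := rank_neg c => rn rc.
by split; apply/kth_alphas; [exists c|exists (neg c)]; split=> //; lia.
Qed.

Lemma CT_condition1P : CT_condition1 w <->
  (forall s t, pos w (alpha t) = (pos w (beta s)).+1 -> opposed (beta s) (alpha t)).
Proof.
split=> [c1 s t adj|ba a b].
  have := c1 (beta s) (alpha t).
  rewrite is_betaE is_alphaE !kind_lett /immediately_before -!/(pos _ _) adj eqxx.
  by move=> /(_ isT isT isT) [e1 e2]; rewrite opposedE e1.
rewrite is_betaE is_alphaE -{2}(lett_kind a) -{2}(lett_kind b).
rewrite /immediately_before -!/(pos _ _) => /negbTE ka kb; rewrite ka kb.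
move=> /eqP /ba; rewrite -{1}ka -{1}kb opposedE !lett_kind.
by case/andP.
Qed.

Lemma CT_condition2P : CT_condition2 w <->
  (forall s t, pos w (alpha t) = (pos w (alpha s)).+1 ->
    pos w (beta t) = (pos w (beta s)).+1 -> s.1 = t.1 -> (toint t < toint s)%R).
Proof.
split=> [c2 s t adja adjb e1|aa a b].
  have := c2 (alpha s) (alpha t).
  rewrite !is_alphaE !kind_lett /immediately_before -!/(pos _ _) adja eqxx !partner_lett.
  rewrite consecutive_beta ?adja // adjb eqxx !positive_lett !subscript_lett.
  by apply.
rewrite !is_alphaE -{2 3 4 5}(lett_kind a) -{2 3 4 5}(lett_kind b) => -> ->.
rewrite /immediately_before -!/(pos _ _) !partner_lett /= => /eqP adj.
by rewrite consecutive_beta ?adj // => /eqP; apply: aa.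
Qed.

Lemma CT_condition4P : CT_condition4 w <->
  (forall s t, (pos w (beta s)).+2 = (2 * n)%N -> pos w (beta t) = (2 * n)%N ->
    s.1 = t.1 -> pos w (alpha t) = (pos w (alpha s)).+1 -> (toint t < toint s)%R).
Proof.
split=> [c4 s t bs bt st adj|bb a b /kth_word pa /kth_word pb].
  have := c4 (beta s) (beta t); rewrite !is_betaE !kind_lett !partner_lett.
  rewrite consecutive_alpha ?adj ?eqxx; last by lia.
  by apply=> //; apply/kth_word; lia.
rewrite !is_betaE -{2 3 4}(lett_kind a) -{2 3 4}(lett_kind b).
move: pa pb; rewrite -{1}(lett_kind a) -{1}(lett_kind b) => pa pb.
case: (kind a) pa => // pa _; case: (kind b) pb => // pb _ st.
rewrite !partner_lett consecutive_alpha; last by lia.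
by move/eqP; apply: bb => //; lia.
Qed.

Lemma CT_condition3P : CT_condition3 w <->
  (forall c, pos w (alpha (neg c)) = (pos w (alpha c)).+1 ->
    c.1 /\ exists e, pos w (alpha c) = (pos w (alpha e)).+1 /\
     (~~ e.1 -> pos w (beta c) = (pos w (beta e)).+1 -> (toint (neg c) < toint e)%R)).
Proof.
have kthb c k : (rank c).+1 = k -> kth (betas w) k (beta c).
  by move=> rc; apply/kth_betas; exists c.
split=> [c3 c adj|mid a b c].
  have [kc knc] := kth_middle adj.
  have rc := rank_adjacent adj; have rn := rank_neg c; rewrite rc in rn.
  have [|e re] := @rank_surj (n - 2); first by lia.
  have [||c1 c2 c4] := c3 (alpha e) (alpha c) (alpha (neg c)) _ kc knc.
  - by apply/kth_alphas; exists e; split=> //; lia.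
  - by rewrite /consecutive /immediately_before -!/(pos _ _) adj eqxx.
  have adje := adj_alpha c1 _; split=> //; exists e; split; first by apply: adje; lia.
  move=> e0 adjb; apply: c4 => // a' b' /kth_betas [x [-> rx]] /kth_betas [y [-> ry]].
  have -> : x = e by apply: rank_inj; lia.
  have -> : y = c by apply: rank_inj; lia.
  by rewrite /consecutive /immediately_before -!/(pos _ _) adjb eqxx.
move=> /kth_alphas [e [-> re]] /kth_alphas [d [-> rd]] /kth_alphas [f [-> rf]].
have -> : f = neg d by apply: rank_inj; have := rank_neg d; lia.
move=> /adj_alpha adj; have {}adj : pos w (alpha (neg d)) = (pos w (alpha d)).+1.
  by apply: adj; have := rank_neg d; lia.
have [d1 [e' [adje third]]] := mid d adj.
have ee : e = e' by apply: rank_inj; have := rank_adjacent adje; lia.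
subst e'; split=> //.
  by rewrite /consecutive /immediately_before -!/(pos _ _) adje eqxx.
move=> e0 /(_ (beta e) (beta d)); rewrite consecutive_beta ?adje //.
move=> /(_ (kthb _ _ re) (kthb _ _ rd)) /eqP adjb.
exact: third.
Qed.

Lemma CT_conditionsP : CT_conditions w <-> pos_conditions w.
Proof.
split=> [[/CT_condition1P ? /CT_condition2P ? /CT_condition3P ? /CT_condition4P ?]|].
  by split.
by case=> ? ? ? ?; split; [apply/CT_condition1P|apply/CT_condition2P|
  apply/CT_condition3P|apply/CT_condition4P].
Qed.

End Ranks.

Local Open Scope classical_set_scope.
Local Open Scope ring_scope.

(** * Points realizing a sketch *)

Section Between.
Variable R : realType.
Implicit Types (U L : seq R) (l u v : R).

Lemma seq_just_above l U : (forall u, u \in U -> l < u) ->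
  exists v, l < v /\ forall u, u \in U -> v < u.
Proof.
elim: U => [_|u U IHU lU]; first by exists (l + 1); split=> //; lra.
have [u' u'U|v [lv vU]] := IHU; first by apply: lU; rewrite inE u'U orbT.
have lu : l < u by apply: lU; rewrite mem_head.
exists (Num.min ((l + u) / 2) v); split.
  by rewrite lt_min lv andbT; lra.
move=> u'; rewrite inE gt_min => /orP[/eqP ->|/vU ->]; last by rewrite orbT.
by apply/orP; left; lra.
Qed.

Lemma seq_between L U : (forall l u, l \in L -> u \in U -> l < u) ->
  exists v, (forall l, l \in L -> l < v) /\ (forall u, u \in U -> v < u).
Proof.
elim: L => [_|l L IHL lLU].
  elim: U => [|u U [v [_ vU]]]; first by exists 0; split.
  exists (Num.min (u - 1) v); split=> // u'; rewrite inE gt_min.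
  by case/orP => [/eqP ->|/vU ->]; [apply/orP; left; lra|rewrite orbT].
have [l' u l'L uU|v [Lv vU]] := IHL; first by apply: lLU => //; rewrite inE l'L orbT.
have [lv|vl] := ltP l v.
  by exists v; split=> // l'; rewrite inE => /orP[/eqP ->//|/Lv].
have [u uU|v' [lv' v'U]] := @seq_just_above l U; first by apply: lLU; rewrite ?mem_head.
exists v'; split=> // l'; rewrite inE => /orP[/eqP ->//|/Lv l'v].
exact: lt_trans l'v (le_lt_trans vl lv').
Qed.

Lemma finite_between (I J : finType) (P : pred I) (Q : pred J) (f : I -> R) (g : J -> R) :
  (forall i j, P i -> Q j -> f i < g j) ->
  exists v, (forall i, P i -> f i < v) /\ (forall j, Q j -> v < g j).
Proof.
move=> fg; have [l u|v [fv vg]] :=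
  @seq_between [seq f i | i <- enum P] [seq g j | j <- enum Q].
  by move=> /mapP[i + ->] /mapP[j + ->]; rewrite !mem_enum; apply: fg.
exists v; split=> [i Pi|j Qj]; [apply: fv|apply: vg];
  by apply: map_f; rewrite mem_enum.
Qed.

End Between.

Section Realization.
Variables (R : realType) (n : nat).
Implicit Types (w u : word n) (s t : signed n) (x y z : 'rV[R]_n).

Lemma value_beta x s : letter_value x (beta s) = letter_value x (alpha s) + 1.
Proof.
by case: s => [[] i]; rewrite /letter_value /positive /=; lra.
Qed.

Lemma value_conjugate x (a : letter n) : letter_value x (conjugate a) = - letter_value x a.
Proof.
by case: a => [[[] i] k]; rewrite /letter_value /positive /=; lra.
Qed.

Lemma sketch_regionP w x : uniq w ->
  sketch_region w x <-> forall a b, (pos w a < pos w b)%N -> letter_value x a < letter_value x b.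
Proof.
move=> uw; rewrite /sketch_region /= sorted_map; split=> [sx a b|incr].
  by apply: (sorted_ltn_index _ sx); rewrite ?wordP // => c d e /=; apply: lt_trans.
case ew : (tval w) => [//|a0 w0]; rewrite -ew; apply/(sortedP a0) => i iw /=.
apply: incr; rewrite /pos index_uniq ?index_uniq //; exact: ltnW.
Qed.

(** Values are chosen along the word. When alpha t0 is reached, its value must
    exceed those of the letters already met and be smaller than y_s + 1 for
    every beta s that is still to come after its alpha-letter; these bounds
    are compatible by the choices made before. This ignores conjugation, so
    the solution is finally averaged with its mirror image: the value of a
    letter a becomes half the difference of the values chosen for a and for
    its conjugate. *)
Lemma realize w : sketch w -> exists x, sketch_region w x.
Proof.
move=> skw; have uw := sk_uniq skw.
pose V (y : signed n -> R) (a : letter n) := y a.1 + (~~ kind a)%:R.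
have [y yP] : exists y : signed n -> R, forall a b, (pos w a < pos w b)%N -> V y a < V y b.
  suff [y yP] : exists y : signed n -> R, forall s t,
      (pos w (alpha s) < 4 * n)%N -> (pos w (alpha t) < 4 * n)%N ->
      [/\ (pos w (alpha s) < pos w (alpha t))%N -> y s < y t,
         (pos w (beta s) < pos w (alpha t))%N -> y s + 1 < y t &
         (pos w (alpha t) < pos w (beta s))%N -> y t < y s + 1].
    exists y => a b; rewrite -(lett_kind a) -(lett_kind b).
    move: (kind a) (kind b) a.1 b.1 => k l s t; rewrite /V !kind_lett /=.
    have [] := yP s t; rewrite ?pos_lt_size // => st bst tbs.
    have [_ _ sbt] := yP t s (pos_lt_size _ uw) (pos_lt_size _ uw).
    case: k l => [] [] /=.
    - by move/st; lra.
    - by move/sbt; lra.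
    - by move/bst; lra.
    by rewrite (beta_mono skw) => /st; lra.
  elim: (4 * n)%N => [|p [y yP]]; first by exists (fun=> 0).
  have [[t0 Pt0]|none] := pselect (exists t0, pos w (alpha t0) = p); last first.
    exists y => s t sp tp; apply: yP.
      by move: sp; rewrite ltnS leq_eqVlt => /orP[/eqP e|//]; case: none; exists s.
    by move: tp; rewrite ltnS leq_eqVlt => /orP[/eqP e|//]; case: none; exists t.
  pose low (a : letter n) := (pos w a < p)%N.
  pose up (a : letter n) := [&& (pos w (alpha a.1) < p)%N, ~~ kind a & (p < pos w a)%N].
  have [a b|v [lowv vup]] := @finite_between R (letter n) (letter n) low up (V y) (V y).
    rewrite -(lett_kind a) -(lett_kind b).
    move: (kind a) (kind b) a.1 b.1 => k l s t; rewrite /V /low /up !kind_lett /=.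
    move=> sp /and3P[tp + pt]; case: l pt => // pt _ /=.
    have abt := sk_alpha_beta skw t; have abs := sk_alpha_beta skw s.
    case: k sp => sp /=.
      by have [_ _ /(_ _)] := yP t s tp sp; rewrite addr0; apply; lia.
    have sp' : (pos w (alpha s) < p)%N by lia.
    have [st _ _] := yP s t sp' tp.
    by rewrite ltrD2r; apply: st; rewrite -(beta_mono skw); lia.
  exists (fun s => if s == t0 then v else y s) => s t sp tp.
  have old s' : s' != t0 -> (pos w (alpha s') < p.+1)%N -> (pos w (alpha s') < p)%N.
    move=> ne; rewrite ltnS leq_eqVlt => /orP[/eqP e|//].
    by move: ne; rewrite (pos_eq skw (etrans e (esym Pt0))).2 eqxx.
  have [es|/old/(_ sp) {}sp] := eqVneq s t0; have [et|/old/(_ tp) {}tp] := eqVneq t t0.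
  - by subst s t; rewrite ltnn; split=> //; [have := sk_alpha_beta skw t0; lia|lra].
  - subst s; split=> [|bt|tb]; [lia|have := sk_alpha_beta skw t0; lia|].
    have := lowv (alpha t) tp; rewrite /V kind_lett /=; lra.
  - subst t; split=> [st|bt|tb].
    + by have := lowv (alpha s); rewrite /low /V kind_lett /= addr0; apply.
    + by have := lowv (beta s); rewrite /low /V kind_lett /= -Pt0; apply.
    + have := vup (beta s); rewrite /up /V kind_lett /= sp -Pt0 tb; exact.
  - exact: yP.
pose x : 'rV[R]_n := \row_i ((y (true, i) - y (false, i) - 1) / 2).
have valx a : letter_value x a = (V y a - V y (conjugate a)) / 2.
  by case: a => [[[] i] []]; rewrite /letter_value /V /conjugate /kind /positive !mxE /=; lra.
exists x; apply/(sketch_regionP _ uw) => a b ab; rewrite !valx.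
have := yP _ _ ab; have := yP (conjugate b) (conjugate a).
case: (sketchP w).2 => // _ conjw _ _ /(_ (conjw _ _ ab)); lra.
Qed.

Lemma sketch_of_point x : injective (letter_value x) ->
  exists w, sketch w /\ sketch_region w x.
Proof.
move=> injx; pose f a := #|[set b | letter_value x b < letter_value x a]%SET|.
have f_mono a b : letter_value x a < letter_value x b -> (f a < f b)%N.
  move=> ab; apply/proper_card/properP; split.
    by apply/fintype.subsetP => c; rewrite !inE => /lt_trans; apply.
  by exists a; rewrite !inE ?ltxx.
have f_lt a b : (f a < f b)%N -> letter_value x a < letter_value x b.
  by have [//|/f_mono|/injx ->] := ltgtP (letter_value x a) (letter_value x b); [lia|rewrite ltnn].
have [a b e|a|w [uw posw]] := @word_of_pos n f.
- by have [/f_mono|/f_mono|/injx//] := ltgtP (letter_value x a) (letter_value x b); lia.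
- rewrite -card_letter; apply/proper_card/properP; split; first exact/fintype.subsetP.
  by exists a; rewrite ?inE ?ltxx.
exists w; split; last by apply/(sketch_regionP _ uw) => a b; rewrite !posw; apply: f_lt.
apply/sketchP; split.
- by split=> // a; apply: wordP.
- move=> a b; rewrite /before -!/(pos _ _) !posw => /f_lt ab; apply: f_mono.
  by rewrite !value_conjugate ltrN2.
- move=> a b a' b' /raisesP[s [-> ->]] /raisesP[t [-> ->]].
  by rewrite /before -!/(pos _ _) !posw => /f_lt ab; apply: f_mono; rewrite !value_beta ltrD2r.
- move=> a a' /raisesP[s [-> ->]]; rewrite /before -!/(pos _ _) !posw.
  by apply: f_mono; rewrite value_beta; lra.
Qed.

End Realization.

(** * Regions and classes of sketches *)

Section Geometry.
Variables (R : realType) (n : nat).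
Implicit Types (w u : word n) (s t : signed n) (x y z : 'rV[R]_n).

Local Notation complement := (arrangement_complement (@CT_arrangement R n)).

(** Moving in the direction (1, ..., n), the value of a letter changes at a
    rate equal to its subscript. Letters of equal value at x have different
    subscripts, hence separate at once, while a short enough step preserves
    the strict inequalities. *)
Lemma perturb x : exists y, injective (letter_value y) /\
  forall a b, letter_value x a < letter_value x b -> letter_value y a < letter_value y b.
Proof.
pose P (ab : letter n * letter n) := letter_value x ab.1 < letter_value x ab.2.
have [i [a b] _|v [v0 vP]] := @finite_between R bool (letter n * letter n)%type predT P (fun=> 0)
    (fun ab => letter_value x ab.2 - letter_value x ab.1).
  by rewrite /P subr_gt0.
pose t := v / (2 * n.+1%:R).
have t0 : 0 < t by rewrite divr_gt0 ?mulr_gt0 ?ltr0n ?(v0 true).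
pose y : 'rV[R]_n := \row_i (x ord0 i + t * (i.+1)%:R).
pose slope (a : letter n) : R := (toint a.1)%:~R.
have valy a : letter_value y a = letter_value x a + t * slope a.
  case: a => [[[] i] k]; rewrite /letter_value /positive /slope /toint /= !mxE ?mulrNz.
    by rewrite pmulrn; ring.
  by rewrite pmulrn; ring.
have slope_le a : `|slope a| <= n.+1%:R.
  case: a => [[b i] k]; have -> : `|slope (b, i, k)| = i.+1%:R.
    by rewrite /slope /toint /=; case: b; rewrite ?mulrNz ?normrN -pmulrn normr_nat.
  by rewrite ler_nat ltnS ltnW.
have mono a b : letter_value x a < letter_value x b -> letter_value y a < letter_value y b.
  move=> ab; have := vP (a, b) ab; rewrite !valy /=.
  have vt : v = t * (2 * n.+1%:R) by rewrite /t divfK // mulf_neq0 ?pnatr_eq0.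
  have := slope_le a; have := slope_le b; rewrite !ler_norml => /andP[b1 _] /andP[_ a2].
  have ta : t * slope a <= t * n.+1%:R by rewrite ler_pM2l.
  have tb : t * (- n.+1%:R) <= t * slope b by rewrite ler_pM2l.
  by rewrite vt; lra.
exists y; split=> // a b e.
have [/mono|/mono|exab] := ltgtP (letter_value x a) (letter_value x b); rewrite ?e ?ltxx //.
move: e; rewrite !valy exab => /addrI /(mulfI (lt0r_neq0 t0)) /eqP.
rewrite /slope eqr_int => /eqP /toint_inj e1.
rewrite -(lett_kind a) -(lett_kind b) e1; congr lett.
move: exab; rewrite -(lett_kind a) -(lett_kind b) e1.
by case: (kind a) (kind b) => [] [] //; rewrite value_beta; lra.
Qed.

Lemma complementP x : complement x <->
  forall a b, opposed a b -> letter_value x a <> letter_value x b.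
Proof.
split=> [cx a b|ne [H [i [j [c [ij cc ->]]]]] /=].
  wlog pa : a b / positive a => [gen ab e|].
    have [pa|na] := boolP (positive a); first exact: (gen a b).
    apply: (gen b a) => //; last by rewrite opposedC.
    by move: ab na; rewrite /opposed /positive; case: (a.1.1) (b.1.1) => [] [].
  case: a b pa => [[[] i] k] [[[] j] l] // _ /andP[_ /= ij] e; apply: cx.
  have e' : x ord0 i + x ord0 j = - (k%:R + l%:R).
    by move: e; rewrite /letter_value /positive /=; lra.
  have cin : - (k%:R + l%:R) \in [:: -2; -1; 0 : R].
    case: (k) (l) => [] [] /=; rewrite !inE ?addr0 ?add0r ?oppr0 ?eqxx ?orbT //.
  have [ij'|ji|/ord_inj e2] := ltngtP i j; last by rewrite e2 eqxx in ij.
    exists [set y : 'rV[R]_n | y ord0 i + y ord0 j = - (k%:R + l%:R)] => //.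
    by exists i, j, (- (k%:R + l%:R)).
  exists [set y : 'rV[R]_n | y ord0 j + y ord0 i = - (k%:R + l%:R)].
    by exists j, i, (- (k%:R + l%:R)).
  by rewrite /= addrC.
move=> e; have ij' : i != j by apply/eqP => e'; move: ij; rewrite e' ltnn.
have contra k l : c = - ((k : bool)%:R + (l : bool)%:R) -> False.
  move=> ec; apply: (ne (true, i, k) (false, j, l)); first by rewrite /opposed /= ij'.
  by rewrite /letter_value /positive /=; lra.
move: cc; rewrite !inE => /or3P[] /eqP ec.
- by apply: (contra true true); rewrite ec /=; lra.
- by apply: (contra true false); rewrite ec /=; lra.
- by apply: (contra false false); rewrite ec /=; lra.
Qed.

Definition same_side x y := forall a b, opposed a b ->
  letter_value x a < letter_value x b -> letter_value y a < letter_value y b.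

Lemma value_segment x y (t : R) a :
  letter_value (x + t *: (y - x)) a = (1 - t) * letter_value x a + t * letter_value y a.
Proof.
by rewrite /letter_value !mxE; case: (positive a); ring.
Qed.

(** A strict inequality that holds at both ends of a segment between values
    affine in the point holds along the segment, which therefore avoids the
    hyperplanes. *)
Lemma same_side_component x y : complement x -> same_side x y ->
  connected_component complement x y.
Proof.
move=> cx xy; pose f (t : R) := x + t *: (y - x).
have cf : continuous f.
  by move=> t; apply: cvgD; [exact: cvg_cst|apply: cvgZr_tmp; exact: cvg_id].
have conn : connected (f @` `[0, 1]).
  apply: connected_continuous_connected; first exact: segment_connected.
  exact: continuous_subspaceT.
apply: (connected_component_max _ _ conn).
- by exists 0; [rewrite /= in_itv /= lexx ler01|rewrite /f scale0r addr0].
- move=> _ [t /= + <-]; rewrite in_itv /= => /andP[t0 t1]; apply/complementP => a b oab.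
  have oba : opposed b a by rewrite opposedC.
  have strict (p q : R) (p' q' : R) : p < q -> p' < q' ->
      (1 - t) * p + t * p' < (1 - t) * q + t * q'.
    move=> pq pq'; have [->|tn0] := eqVneq t 0; first by lra.
    have tp : 0 < t by rewrite lt0r tn0.
    have : t * p' < t * q' by rewrite ltr_pM2l.
    have : (1 - t) * p <= (1 - t) * q by rewrite ler_wpM2l ?subr_ge0 // ltW.
    by lra.
  rewrite !value_segment.
  have [ab|ba|e] := ltgtP (letter_value x a) (letter_value x b).
  + by have := strict _ _ _ _ ab (xy _ _ oab ab); lra.
  + by have := strict _ _ _ _ ba (xy _ _ oba ba); lra.
  + by case: ((complementP x).1 cx a b oab).
- by exists 1; [rewrite /= in_itv /= lexx ler01|rewrite /f scale1r addrC subrK].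
Qed.

(** On a connected set avoiding the hyperplanes, the difference of the values
    of two opposed letters has no zero, hence a constant sign. *)
Lemma component_same_side x y : connected_component complement x y -> same_side x y.
Proof.
move=> xy a b oab; have [cx yC] : complement x /\ complement y.
  split; last exact: (connected_component_sub xy).
  exact: (connected_component_sub (connected_component_sym xy)).
pose g z := letter_value z b - letter_value z a.
have cv c : continuous (fun z : 'rV[R]_n => letter_value z c).
  have ci : continuous (fun z : 'rV[R]_n => z ord0 c.1.2) by apply: coord_continuous.
  move=> z; rewrite /letter_value; case: (positive c).
    by apply: (continuousD (ci z)); exact: cst_continuous.
  by apply: (continuousB (continuousN (ci z))); exact: cst_continuous.
have cg : continuous g by move=> z; apply: (continuousB (cv b z) (cv a z)).
have /connected_intervalP itv : connected (g @` connected_component complement x).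
  apply: connected_continuous_connected; first exact: component_connected.
  exact: continuous_subspaceT.
move=> ab; have [//|ba|e] := ltgtP (letter_value y a) (letter_value y b); last first.
  by case: ((complementP y).1 yC a b oab).
have [|||z zC] := @itv (g y) (g x) _ _ 0.
- by exists y.
- by exists x => //; apply: connected_component_refl.
- by rewrite /g; apply/andP; split; lra.
rewrite /g => /eqP; rewrite subr_eq0 eq_sym => /eqP e.
by case: ((complementP z).1 (connected_component_sub zC) a b oab).
Qed.

Lemma region_value w x a b : uniq w -> sketch_region w x ->
  (letter_value x a < letter_value x b) = (pos w a < pos w b)%N.
Proof.
move=> uw /(sketch_regionP _ uw) incr; apply/idP/idP; last exact: incr.
have [//|/incr|/(pos_inj uw) ->] := ltngtP (pos w a) (pos w b); last by rewrite ltxx.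
by move=> ba /(lt_trans ba); rewrite ltxx.
Qed.

Lemma region_complement w x : uniq w -> sketch_region w x -> complement x.
Proof.
move=> uw rx; apply/complementP => a b oab e.
have := region_value a b uw rx; have := region_value b a uw rx; rewrite e ltxx.
move=> h1 h2; have /(pos_inj uw) e' : pos w a = pos w b by lia.
by move: oab; rewrite /opposed e' eqxx.
Qed.

Lemma region_in_component w u x : sketch w -> sketch u -> same_class w u ->
  sketch_region w x -> sketch_region u `<=` connected_component complement x.
Proof.
move=> /sk_uniq uw /sk_uniq uu wu wx y uy; apply: same_side_component.
  exact: region_complement wx.
move=> a b oab; rewrite (region_value _ _ uw wx) (region_value _ _ uu uy).
exact: wu.
Qed.

Lemma same_class_sym w u : sketch w -> sketch u -> same_class w u -> same_class u w.
Proof. by move=> skw sku wu a b oab; rewrite -(sameE skw wu oab). Qed.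

Lemma CT_equivalentP w u : sketch w -> sketch u -> CT_equivalent R w u <-> same_class w u.
Proof.
move=> skw sku; have uw := sk_uniq skw; have uu := sk_uniq sku.
have [x wx] := realize R skw; have [y uy] := realize R sku.
split=> [[C [[x0 cx0 ->] /(_ _ wx) x0x /(_ _ uy) x0y]] a b oab|wu].
  rewrite -(region_value _ _ uw wx) -(region_value _ _ uu uy) => ab.
  have /component_same_side xy : connected_component complement x y.
    by apply: connected_component_trans x0y; apply: connected_component_sym.
  exact: xy.
exists (connected_component complement x); split.
- by exists x => //; apply: region_complement wx.
- exact: region_in_component wx.
- exact: region_in_component wx.
Qed.

Lemma CT_maximalP w : (2 <= n)%N -> sketch w -> CT_maximal R w <-> pos_conditions w.
Proof.
move=> n2 skw; split=> [[_ wmax]|gw].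
  apply: maximal_conditions => // u sku wu; apply/negP => lt_wu.
  have [e|/eqP ne] := eqVneq u w.
    by move: lt_wu; rewrite e /word_lt ltxx.
  have := wmax u ((sketchP u).2 sku) ne ((CT_equivalentP skw sku).2 wu).
  by move/(lt_trans lt_wu); rewrite ltxx.
split=> [|u /sketchP sku /eqP ne /(CT_equivalentP skw sku) wu]; first exact/sketchP.
by apply: (conditions_maximal skw sku gw wu); rewrite eq_sym.
Qed.

(** There are finitely many words, and the keys of words are totally
    ordered. *)
Lemma exists_maximal w : (2 <= n)%N -> sketch w ->
  exists u, [/\ sketch u, pos_conditions u & same_class w u].
Proof.
move=> n2 skw; pose key (u : word n) : (4 * n).-tuplelexi (bool *l int)%type :=
  [tuple of map (@letter_key n) u].
pose P u := `[< sketch u /\ same_class w u >].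
have Pw : P w by apply/asboolP; split.
case: (@arg_maxP _ _ _ w P key Pw) => u /asboolP[sku wu] umax.
exists u; split=> //; apply: maximal_conditions => // v skv uv.
have Pv : P v by apply/asboolP; split=> //; apply: same_class_trans wu uv.
by rewrite /word_lt -leNgt; apply: umax.
Qed.

End Geometry.

Unset Implicit Arguments.

Theorem theorem7p5 (R : realType) (n : nat) (hn : (2 <= n)%N) :
  (forall w : word n, symmetric_sketch w ->
     (CT_maximal R w <-> CT_conditions w)) /\
  (exists f : word n -> set 'rV[R]_n,
     set_bij [set w : word n | symmetric_sketch w /\ CT_conditions w]
             (regions (@CT_arrangement R n)) f /\
     (forall w : word n, symmetric_sketch w -> CT_conditions w ->
        sketch_region w `<=` f w)).
Proof.
have maxP (w : word n) : sketch w -> CT_maximal R w <-> CT_conditions w.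
  move=> skw; rewrite CT_maximalP //; split=> /CT_conditionsP; exact.
split=> [w /sketchP|]; first exact: maxP.
(* A sketch is sent to the component of a chosen point of its region, which
   by [region_in_component] contains the whole region of the sketch. *)
pose cc := connected_component (arrangement_complement (@CT_arrangement R n)).
pose pt (w : word n) := xget 0 (sketch_region (R := R) w).
have ptP (w : word n) : sketch w -> sketch_region w (pt w).
  by move=> skw; apply: xgetPex; apply: realize.
exists (fun w : word n => cc (pt w)); split; last first.
  by move=> w /sketchP skw _; apply: (region_in_component skw skw _ (ptP w skw)).
split.
- move=> w [/sketchP skw _] /=; exists (pt w) => //.
  exact: region_complement (sk_uniq skw) (ptP w skw).
- move=> w u /set_mem [/sketchP skw /(CT_conditionsP skw hn) gw].
  move=> /set_mem [/sketchP sku /(CT_conditionsP sku hn) gu] e.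
  have wu : same_class w u.
    apply/(CT_equivalentP R skw sku); exists (cc (pt w)); split.
    + by exists (pt w) => //; apply: region_complement (sk_uniq skw) (ptP w skw).
    + by apply: (region_in_component skw skw _ (ptP w skw)).
    + by rewrite e; apply: (region_in_component sku sku _ (ptP u sku)).
  have uw := same_class_sym skw sku wu.
  apply/eqP/negPn/negP => ne.
  have lt_uw := conditions_maximal skw sku gw wu ne.
  have ne' : u != w by rewrite eq_sym.
  have lt_wu := conditions_maximal sku skw gu uw ne'.
  by move: (lt_trans lt_uw lt_wu); rewrite ltxx.
move=> _ [x cx ->]; have [y [injy xy]] := perturb x.
have [w [skw wy]] := sketch_of_point injy.
have [u [sku gu wu]] := exists_maximal hn skw.
exists u; first by split; [apply/sketchP|apply/(CT_conditionsP sku hn)].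
have yu : cc y (pt u) by apply: (region_in_component skw sku wu wy); apply: ptP.
have xy' : cc x y by apply: same_side_component => // a b _; apply: xy.
by rewrite /cc (same_connected_component xy') (same_connected_component yu).
Qed.
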